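(* Let $(X,Q),(X_1,Q_1),(X_2,Q_2),\dots$ be independent identically distributed bivariate random variables with values in $\{0,1,2,\dots\}\times[0,1]$. Assume that $$\mathbf{E}\bigl(Q\,\mathbb{I}_{\{X\ge 2\}}\bigr)>0\qquad\text{and}\qquad\mathbf{E}\bigl(X\,h(X,Q)\ln(1+X)\bigr)<\infty .$$ Let $m=m(n)$ be a sequence of positive integers with $m(n)\to+\infty$ as $n\to+\infty$. For each $n\ge 1$ let $G_{[n,m]}$ be the community affiliation graph on the vertex set $[n]$ defined by the sequence $(\tilde X_{n,1},Q_1),\dots,(\tilde X_{n,m},Q_m)$, where $\tilde X_{n,i}=\min\{X_i,n\}$. Put $$\kappa=\mathbf{E}\bigl(X\,h(X,Q)\bigr),\qquad \lambda'_{n,m}=\ln n-\frac{m}{n}\kappa .$$ Then, as $n\to+\infty$: (i) if $\lambda'_{n,m}\to+\infty$, then $\mathbf{P}\{G_{[n,m]}\text{ is connected}\}\to 0$; (ii) if $\lambda'_{n,m}\to-\infty$, then $\mathbf{P}\{G_{[n,m]}\text{ is connected}\}\to 1$.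
   Context: Notation: $[n]=\{1,\dots,n\}$; $(a)_+=\max\{a,0\}$; $\mathbb{I}_{\mathcal A}$ is the indicator of the event $\mathcal A$. For $x\ge 0$ and $0\le q\le 1$ put $h(x,q)=1-(1-q)^{(x-1)_+}$, with the convention $0^0=1$. Random graph model: given independent bivariate random variables $(X_{n,1},Q_{n,1}),\dots,(X_{n,m},Q_{n,m})$ with values in $\{0,1,\dots,n\}\times[0,1]$, define independent random graphs (communities) $G_{n,i}=(\mathcal V_{n,i},\mathcal E_{n,i})$, $i\in[m]$, as follows. First sample $(X_{n,i},Q_{n,i})$. Then, given $(X_{n,i},Q_{n,i})$, select the vertex set $\mathcal V_{n,i}\subset[n]$ uniformly at random among all subsets of $[n]$ of size $X_{n,i}$, and link every pair of elements of $\mathcal V_{n,i}$ by an edge independently with probability $Q_{n,i}$; $\mathcal E_{n,i}$ is the resulting edge set. The community affiliation graph defined by the sequence is the graph $G_{[n,m]}=([n],\bigcup_{i\in[m]}\mathcal E_{n,i})$ with the non-random vertex set $[n]$. *)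

(* Defs.v *)
From HB Require Import structures.
From mathcomp Require Import all_boot all_order all_algebra.
From mathcomp Require Import all_classical all_reals all_analysis.

Set Implicit Arguments.
Unset Strict Implicit.
Unset Printing Implicit Defensive.

Import Order.TTheory GRing.Theory Num.Theory.
Import numFieldNormedType.Exports.

Local Open Scope classical_set_scope.
Local Open Scope ring_scope.

(* The exponent is [x - 1] truncated at 0, and [0 ^+ 0 = 1]. *)
Definition h {R : realType} (x : nat) (q : R) : R := 1 - (1 - q) ^+ (x - 1)%N.

(* A vertex set together with an edge set. *)
Definition community (n : nat) : Type := ({set 'I_n} * {set {set 'I_n}})%type.

HB.instance Definition _ (n : nat) := Finite.on (community n).
HB.instance Definition _ (n : nat) :=
  isPointed.Build (community n) (finset.set0, finset.set0).
(* The discrete sigma-algebra on the finite set of communities. *)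
HB.instance Definition _ (n : nat) := @isMeasurable.Build default_measure_display
  (community n) (@discrete_measurable (community n))
  (@discrete_measurable0 (community n))
  (@discrete_measurableC (community n))
  (@discrete_measurableU (community n)).

Definition pairs (n : nat) (v : {set 'I_n}) : {set {set 'I_n}} :=
  [set f in powerset v | #|f| == 2%N]%SET.

Definition connected_graph (n : nat) (E : {set {set 'I_n}}) : bool :=
  [forall x, forall y, connect (fun a b => [set a; b]%SET \in E) x y].

Definition mutually_independent {d d'} {Omega : measurableType d}
    {T : measurableType d'} {R : realType} (P : probability Omega R)
    {I : eqType} (Z : I -> Omega -> T) : Prop :=
  forall (J : seq I) (B : I -> set T), uniq J ->
    (forall i, i \in J -> measurable (B i)) ->
    P (\bigcap_(i in [set` J]) Z i @^-1` B i) =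
    (\prod_(i <- J) P (Z i @^-1` B i))%E.

(* For [0 <= q <= 1] and [x <= n], the probability of [g] when the vertex set
   is uniform among the subsets of ['I_n] of size [x] and the pairs of vertices
   are then linked independently with probability [q]. *)
Definition community_pmf {R : realType} (n x : nat) (q : R)
    (g : community n) : R :=
  if (#|g.1| == x) && (g.2 \subset pairs g.1) then
    ('C(n, x)%:R)^-1 * \prod_(f in pairs g.1) (if f \in g.2 then q else 1 - q)
  else 0.

(* [G i] is the community defined by [XQ i]: the last clause says that
   [community_pmf] at [XQ i] is the conditional law of [G i] given [XQ i]. *)
Definition communities {d} {Omega : measurableType d} {R : realType}
    (P : probability Omega R) (n m : nat)
    (XQ : 'I_m -> Omega -> nat * R) (G : 'I_m -> Omega -> community n) : Prop :=
  [/\ forall i, measurable_fun setT (XQ i) /\ measurable_fun setT (G i),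
      forall i w, ((XQ i w).1 <= n)%N /\ 0 <= (XQ i w).2 <= 1,
      mutually_independent P (fun i w => (XQ i w, G i w)) &
      forall i (B : set (nat * R)) (g : community n), measurable B ->
        P (XQ i @^-1` B `&` G i @^-1` [set g]) =
        (\int[P]_(w in XQ i @^-1` B)
           (community_pmf (XQ i w).1 (XQ i w).2 g)%:E)%E].

Definition affiliation_graph (n m : nat) (g : 'I_m -> community n) :
    {set {set 'I_n}} :=
  (\bigcup_(i < m) (g i).2)%SET.

(* Main.v *)
(* The communities are i.i.d. with a law on a finite type, so [P] can be replaced
   by a finite product of weights.

   Let [p_S] be the probability that one community has an edge leaving [S], and
   let [L = ln n], [tail T = E (X h(X,Q) 1_{X > T})].  Given the size [x] of the
   community, the number [a] of its members in [S] is hypergeometric, and an edge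
   leaves [S] with probability [1 - (1-q)^{a(x-a)}], which dominates both
   [h(x,q) (a - a(a-1))] and, for [x >= 2], [q a(x-a)/x^2].  Hence only the first
   two factorial moments of [a] matter, and they give
     [p_S >= |S|/n (1 - |S| T/n) (kappa - tail T)]  for [T <= n],
     [p_S >= |S|/(4n) E(Q 1_{X >= 2})]  for [2|S| <= n].

   Supercritical case: a disconnected graph has no edge leaving some [S] with
   [0 < |S| <= n/2].  With [T = n^delta], the first bound is used when
   [|S| <= n^{1 - 2 delta}] and the second one otherwise; both sums over [S] reduce
   to [\sum_S a^|S| = (1+a)^n].  The logarithmic moment is what makes
   [tail (n^delta) L] tend to 0.

   Subcritical case: the second moment method for the number of isolated vertices.
   The correlation of two vertices is at most [(T kappa + n tail T)/n^2], used with
   [T = n^{1/2}]. *)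

Require Import Defs.
From HB Require Import structures.
From mathcomp Require Import all_boot all_order all_algebra.
From mathcomp Require Import all_classical all_reals all_analysis.
From mathcomp Require Import measurable_realfun ring lra.

Set Implicit Arguments.
Unset Strict Implicit.
Unset Printing Implicit Defensive.

Import Order.TTheory GRing.Theory Num.Theory.
Import numFieldNormedType.Exports.

(** * Edge cuts *)

Local Open Scope ring_scope.

Section cuts.
Variable n : nat.
Implicit Types (S V : {set 'I_n}) (D E : {set {set 'I_n}}).

Definition edge_cut S : {set {set 'I_n}} :=
  [set f : {set 'I_n} | (#|f| == 2%N) && (#|f :&: S| == 1%N)]%SET.

Lemma in_cut2 S a b : a \in S -> b \notin S -> [set a; b]%SET \in edge_cut S.
Proof.
move=> aS bS; have ab : a != b by apply: contraNneq bS => <-.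
rewrite inE cards2 ab /=; apply/cards1P; exists a.
apply/setP => z; rewrite !inE; have [->|za]/= := eqVneq z a; first by rewrite aS.
by have [->|//] := eqVneq z b; rewrite (negbTE bS).
Qed.

Lemma cutP S f : f \in edge_cut S ->
  exists a b, [/\ f = [set a; b]%SET, a \in S & b \notin S].
Proof.
rewrite inE => /andP[/cards2P[a [b [ab ->]]]] /cards1P[c fS].
have : a \in [set c]%SET = (a \in S) by rewrite -fS !inE eqxx.
have : b \in [set c]%SET = (b \in S) by rewrite -fS !inE eqxx orbT.
have : c \in [set a; b]%SET.
  have : c \in [set c]%SET by rewrite inE.
  by rewrite -fS inE => /andP[].
have ba : (b == a) = false by rewrite eq_sym (negbTE ab).
rewrite !inE => /orP[] /eqP ->; rewrite eqxx ?ba ?(negbTE ab).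
  by move=> bS aS; exists a, b; rewrite -aS -bS.
by move=> bS aS; exists b, a; rewrite -aS -bS finset.setUC.
Qed.

Lemma cutC S : edge_cut (~: S)%SET = edge_cut S.
Proof.
have sub S' : {subset edge_cut (~: S')%SET <= edge_cut S'}.
  move=> f /cutP[a [b [-> aS bS]]]; rewrite finset.setUC; apply: in_cut2.
    by rewrite inE negbK in bS.
  by rewrite inE in aS.
apply/setP => f; apply/idP/idP => [/sub//|fS].
by apply: (sub (~: S)%SET); rewrite finset.setCK.
Qed.

(** Send a member of [S :&: V] and a member of [V :\: S] to the pair they form; this map is
    injective because only one end of the pair lies in [S]. *)
Lemma card_pairs_cut V S :
  #|pairs V :&: edge_cut S|%SET = (#|S :&: V|%SET * (#|V| - #|S :&: V|%SET))%N.
Proof.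
have -> : (#|V| - #|S :&: V|%SET = #|V :\: S|%SET)%N by rewrite cardsD finset.setIC.
rewrite -cardsX.
rewrite -(card_in_imset (f := fun p : 'I_n * 'I_n => [set p.1; p.2]%SET)); last first.
  move=> [a b] [c e]; rewrite !inE /= => /andP[/andP[aS aV] /andP[bS bV]].
  move=> /andP[/andP[cS cV] /andP[eS eV]] ab_ce.
  have : a \in [set c; e]%SET by rewrite -ab_ce !inE eqxx.
  have : b \in [set c; e]%SET by rewrite -ab_ce !inE eqxx orbT.
  rewrite !inE => /orP[/eqP bc|/eqP ->]; first by move: bS; rewrite bc cS.
  by move=> /orP[/eqP ->//|/eqP ae]; move: eS; rewrite -ae aS.
congr #|pred_of_set _|; apply/setP => f; apply/setIP/imsetP => [[]|].
  rewrite inE => /andP[]; rewrite powersetE => fV _ /cutP[a [b [fE aS bS]]].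
  exists (a, b) => //=; rewrite !inE aS bS /=.
  by move: fV; rewrite fE => /fintype.subsetP fV; rewrite !fV// !inE eqxx ?orbT.
move=> [[a b]]; rewrite !inE /= => /andP[/andP[aS aV] /andP[bS bV]] ->.
have := in_cut2 aS bS; rewrite inE => /andP[-> ->]; split => //.
by rewrite andbT; apply/fintype.subsetP => z; rewrite !inE => /orP[] /eqP ->.
Qed.

Lemma connect_cut E S a b : [disjoint E & edge_cut S] ->
  connect (fun a b => [set a; b]%SET \in E) a b -> (a \in S) = (b \in S).
Proof.
move=> ES; apply: (closed_connect (a := mem S)) => {}a {}b /= abE.
have abS : [set a; b]%SET \notin edge_cut S.
  by apply/negP => abS; move/pred0P : ES => /(_ [set a; b]%SET) /=; rewrite abE abS.
apply/idP/idP => ?; apply: contraNT abS => ?; first exact: in_cut2.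
by rewrite finset.setUC; exact: in_cut2.
Qed.

(** No edge leaves the set of vertices reachable from [x], nor its complement, and both are
    nonempty; one of the two has at most half of the vertices. *)
Lemma disconnected_cut E : ~~ connected_graph E ->
  exists S, [/\ (0 < #|S|)%N, (2 * #|S| <= n)%N & [disjoint E & edge_cut S]].
Proof.
rewrite negb_forall => /existsP[x]; rewrite negb_forall => /existsP[y xy].
pose e a b := [set a; b]%SET \in E.
pose S := [set z | connect e x z]%SET.
have ES : [disjoint E & edge_cut S].
  apply/pred0P => f /=; apply/negP => /andP[fE /cutP[a [b [fab]]]].
  rewrite !inE => xa /negP; apply; apply: (connect_trans xa).
  by apply: connect1; rewrite /e -fab.
have [nS|nS] := leqP (2 * #|S|) n.
  by exists S; split => //; apply/card_gt0P; exists x; rewrite inE connect0.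
exists (~: S)%SET; split.
- by apply/card_gt0P; exists y; rewrite !inE.
- have := cardsC S; rewrite card_ord => nE.
  by rewrite -[leqRHS]nE mul2n -addnn leq_add2r -(leq_add2l #|S|) nE addnn -mul2n ltnW.
- by rewrite cutC.
Qed.

Lemma isolated_disconnected E v : (1 < n)%N -> [disjoint E & edge_cut [set v]%SET] ->
  ~~ connected_graph E.
Proof.
move=> n1 Ev; apply/negP => /forallP/(_ v)/forallP cv.
have : (0 < #|~: [set v]|%SET)%N.
  by have := cardsC [set v]%SET; rewrite cards1 card_ord => nE; rewrite -(ltn_add2l 1) nE addn0.
move=> /card_gt0P[y]; rewrite !inE => yv.
by have := connect_cut Ev (cv y); rewrite !inE eqxx (negbTE yv).
Qed.

End cuts.

Lemma affiliation_disjoint n m (g : 'I_m -> community n) (D : {set {set 'I_n}}) :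
  [disjoint affiliation_graph g & D] = [forall i, [disjoint (g i).2 & D]].
Proof.
apply/idP/forallP => [dD i|dD].
  apply: disjointWl dD; apply/fintype.subsetP => f fi.
  by apply/finset.bigcupP; exists i.
apply/pred0P => f /=; apply/negP => /andP[/finset.bigcupP[i _ fi] fD].
by have /pred0P/(_ f) := dD i; rewrite /= fi fD.
Qed.

(** * The law of one community given its size and edge probability *)

Section community_weights.
Variables (R : realType) (n : nat).
Implicit Types (x : nat) (q : R) (S V : {set 'I_n}) (D E : {set {set 'I_n}}).

(** Each pair outside [D] is free and contributes q + (1 - q) = 1; each pair in [D] must be absent
    and contributes 1 - q. *)
Lemma sum_edge_weights V D q :
  \sum_(E : {set {set 'I_n}} | (E \subset pairs V) && [disjoint E & D])
     \prod_(f in pairs V) (if f \in E then q else 1 - q) =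
  (1 - q) ^+ #|pairs V :&: D|%SET.
Proof.
(* The product is extended to all sets [f], those that are not pairs of [V] contributing 0 + 1, so
   that distributing it gives a sum over all edge sets. *)
transitivity (\prod_f ((if f \in pairs V :\: D then q else 0) +
                       (if f \in pairs V then 1 - q else 1)))%SET; last first.
  rewrite -prodr_const [RHS]big_mkcond; apply: eq_bigr => f _.
  by rewrite finset.in_setD finset.in_setI; case: (f \in D); case: (f \in pairs V) => //=; rewrite ?add0r// addrC subrK.
rewrite bigA_distr big_mkcond; apply: eq_bigr => E _ /=.
have -> : (E \subset pairs V) && [disjoint E & D] = (E \subset pairs V :\: D)%SET.
  by rewrite subsetD.
case: ifP => [/fintype.subsetP ED|/negbT/subsetPn[f fE fD]].
  rewrite big_mkcond; apply: eq_bigr => f _.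
  have := ED f; case: (f \in E) => [/(_ isT) fD|_//].
  by rewrite fD; move: fD; rewrite finset.in_setD => /andP[_ ->].
by rewrite (bigD1 f)//= fE (negbTE fD) mul0r.
Qed.

Lemma sum_community_pmf x q (A : pred {set 'I_n}) D :
  \sum_(g : community n | A g.1 && [disjoint g.2 & D]) community_pmf x q g =
  ('C(n, x)%:R)^-1 * \sum_(V : {set 'I_n} | A V && (#|V| == x))
    (1 - q) ^+ #|pairs V :&: D|%SET.
Proof.
rewrite mulr_sumr -(pair_big_dep A (fun V E => [disjoint E & D])
  (fun V E => community_pmf x q (V, E))) /=.
rewrite [RHS]big_mkcondr; apply: eq_bigr => V _.
rewrite /community_pmf /=; case: ifP => Vx /=; last by rewrite big1.
rewrite -sum_edge_weights mulr_sumr [LHS]big_mkcond [RHS]big_mkcond.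
by apply: eq_bigr => E _; rewrite andbC; case: [disjoint E & D].
Qed.

Lemma community_pmf_ge0 x q (g : community n) : 0 <= q <= 1 -> 0 <= community_pmf x q g.
Proof.
move=> /andP[q0 q1]; rewrite /community_pmf; case: ifP => // _.
apply: mulr_ge0; first by rewrite invr_ge0.
by apply: prodr_ge0 => f _; case: ifP; rewrite ?subr_ge0.
Qed.

(** A superset of [V] of size [x] is [V] together with [x - #|V|] elements of its complement. *)
Lemma card_supersets V x : (#|V| <= x)%N ->
  #|[set W : {set 'I_n} | (V \subset W) && (#|W| == x)]|%SET = 'C(n - #|V|, x - #|V|).
Proof.
move=> Vx; have <- : #|~: V|%SET = (n - #|V|)%N.
  by have := cardsC V; rewrite card_ord => nE; rewrite -[X in (X - _)%N]nE addKn.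
rewrite -cards_draws -[RHS](card_in_imset (f := fun W => V :|: W)%SET); last first.
  move=> W W'; rewrite !inE => /andP[WV _] /andP[W'V _] /setP WW'; apply/setP => z.
  have := WW' z; rewrite !inE.
  have := fintype.subsetP WV z; have := fintype.subsetP W'V z; rewrite !inE.
  by case: (z \in V) => //=; case: (z \in W) => //; case: (z \in W') => // _ /(_ isT).
congr #|pred_of_set _|; apply/setP => W; rewrite inE; apply/andP/imsetP => [[VW Wx]|[U]].
  exists (W :\: V)%SET; last first.
    apply/setP => z; have := fintype.subsetP VW z; rewrite !inE.
    by case: (z \in V) => //= ->.
  rewrite inE cardsD (finset.setIidPr VW) (eqP Wx) eqxx andbT.
  by apply/fintype.subsetP => z; rewrite !inE => /andP[].
rewrite inE => /andP[UV Ux] ->; split; first exact: finset.subsetUl.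
rewrite cardsU (_ : (V :&: U)%SET = finset.set0) ?cards0 ?subn0 ?(eqP Ux) ?subnKC//.
by apply/eqP; rewrite setI_eq0 disjoint_sym finset.disjoints_subset.
Qed.

(** The expectation of [F] over a uniform random subset of size [x]; for [x > n] the sum is empty
    and the value is 0. *)
Definition vset_mean x (F : {set 'I_n} -> R) : R :=
  ('C(n, x)%:R)^-1 * \sum_(V : {set 'I_n} | #|V| == x) F V.

Lemma vset_meanD x F1 F2 :
  vset_mean x (fun V => F1 V + F2 V) = vset_mean x F1 + vset_mean x F2.
Proof. by rewrite /vset_mean big_split mulrDr. Qed.

Lemma vset_meanZ x c F : vset_mean x (fun V => c * F V) = c * vset_mean x F.
Proof. by rewrite /vset_mean -mulr_sumr mulrCA. Qed.

Lemma ler_vset_mean x F1 F2 : (forall V, #|V| = x -> F1 V <= F2 V) ->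
  vset_mean x F1 <= vset_mean x F2.
Proof.
by move=> F12; rewrite ler_wpM2l ?invr_ge0// ler_sum// => V /eqP; exact: F12.
Qed.

Lemma eq_vset_mean x F1 F2 : (forall V, #|V| = x -> F1 V = F2 V) ->
  vset_mean x F1 = vset_mean x F2.
Proof. by move=> F12; congr (_ * _); apply: eq_bigr => V /eqP; exact: F12. Qed.

Lemma bin_unit x : (x <= n)%N -> 'C(n, x)%:R != 0 :> R.
Proof. by move=> xn; rewrite pnatr_eq0 -lt0n bin_gt0. Qed.

Lemma vset_mean_sub x S : (#|S| <= x <= n)%N ->
  vset_mean x (fun V => (S \subset V)%:R) =
  ('C(n, x)%:R)^-1 * 'C(n - #|S|, x - #|S|)%:R.
Proof.
move=> /andP[Sx xn]; congr (_ * _); rewrite -card_supersets// -sum1_card natr_sum.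
rewrite big_mkcond [RHS]big_mkcond; apply: eq_bigr => V _; rewrite inE.
by case: (S \subset V); case: (#|V| == x).
Qed.

Lemma vset_mean1 x : (x <= n)%N -> vset_mean x (fun=> 1) = 1.
Proof.
move=> xn; have := @vset_mean_sub x finset.set0; rewrite cards0 xn !subn0 => /(_ isT).
rewrite mulVf ?bin_unit// => mean1; rewrite -[RHS]mean1.
by apply: eq_vset_mean => V _; rewrite finset.sub0set.
Qed.

Lemma vset_mean_in x v : (x <= n)%N ->
  vset_mean x (fun V => (v \in V)%:R) = x%:R / n%:R.
Proof.
move=> xn; have n0 : n%:R != 0 :> R by rewrite pnatr_eq0 -lt0n (leq_ltn_trans _ (ltn_ord v)).
case: x xn => [|x] xn.
  rewrite mul0r /vset_mean big1 ?mulr0// => V /eqP/cards0_eq ->.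
  by rewrite finset.in_set0.
transitivity (vset_mean x.+1 (fun V => ([set v]%SET \subset V)%:R)).
  by apply: eq_vset_mean => V _; rewrite finset.sub1set.
rewrite vset_mean_sub cards1//; apply/(mulfI n0).
rewrite [RHS]mulrC divfK// mulrCA -natrM !subn1 mul_bin_diag natrM mulrC.
by rewrite mulfK// bin_unit.
Qed.

Lemma vset_mean_in2 x u v : (x <= n)%N -> u != v ->
  vset_mean x (fun V => (u \in V)%:R * (v \in V)%:R) =
  x%:R * (x%:R - 1) / (n%:R * (n%:R - 1)).
Proof.
move=> xn uv.
have n1 : (1 < n)%N.
  by have := max_card [set u; v]%SET; rewrite cards2 uv card_ord.
have n0 : n%:R != 0 :> R by rewrite pnatr_eq0 -lt0n ltnW.
have nn0 : n%:R - 1 != 0 :> R by rewrite subr_eq0 (eqr_nat _ n 1) neq_ltn n1 orbT.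
transitivity (vset_mean x (fun V => ([set u; v]%SET \subset V)%:R)).
  by apply: eq_vset_mean => V _; rewrite finset.subUset (finset.sub1set V u) (finset.sub1set V v) -mulnb natrM.
have [x2|x2] := ltnP x 2.
  have -> : x%:R * (x%:R - 1) = 0 :> R.
    by case: x x2 {xn} => [|[|//]] _; rewrite ?subrr ?mulr0 ?mul0r.
  rewrite mul0r /vset_mean big1 ?mulr0// => V /eqP Vx.
  case: (boolP ([set u; v]%SET \subset V)) => //.
  by move=> /subset_leq_card; rewrite cards2 uv Vx leqNgt x2.
rewrite vset_mean_sub cards2 uv ?x2//= /addn /=.
(* The absorption identity of binomial coefficients, applied twice. *)
have xE : 'C(n, x)%:R * (x%:R * (x%:R - 1)) = n%:R * ((n%:R - 1) * 'C(n - 2, x - 2)%:R) :> R.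
  case: x x2 xn => [|[|x]]// _ _; case: {u v uv} n n1 => [|[|k]]// _.
  have pred2 i : i.+2%:R - 1 = i.+1%:R :> R by rewrite -natr1 addrK.
  rewrite !subSS !subn0 !pred2 -!natrM (mul_bin_diag k.+1 x); congr _%:R.
  rewrite [RHS]mulnCA (mul_bin_diag k.+2 x.+1).
  by rewrite mulnC -mulnA mulnCA.
rewrite -[LHS]mul1r; apply/(mulfI (bin_unit xn)).
rewrite mul1r mulrA divff ?bin_unit// mul1r mulrA xE.
by rewrite [X in X / _]mulrA [RHS]mulrAC divff ?mul1r// mulf_neq0.
Qed.

Lemma card_setI_sum S V : #|S :&: V|%SET%:R = \sum_(v in S) (v \in V)%:R :> R.
Proof.
rewrite -sum1_card natr_sum big_mkcond [RHS]big_mkcond; apply: eq_bigr => v _.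
by rewrite finset.in_setI; case: (v \in S); case: (v \in V).
Qed.

Lemma vset_mean_card x S : (x <= n)%N ->
  vset_mean x (fun V => #|S :&: V|%SET%:R) = #|S|%:R * x%:R / n%:R.
Proof.
move=> xn; under [LHS]eq_vset_mean do rewrite card_setI_sum.
rewrite /vset_mean exchange_big mulr_sumr /=.
under eq_bigr => v _ do rewrite -/(vset_mean x (fun V => (v \in V)%:R)) vset_mean_in//.
by rewrite sumr_const -mulrA -[LHS]mulr_natl.
Qed.

(** A hypergeometric factorial moment: with a = [#|S :&: V|], the product a (a - 1) counts the
    ordered pairs of distinct elements of [S] that both lie in [V]. *)
Lemma vset_mean_card2 x S : (x <= n)%N ->
  vset_mean x (fun V => #|S :&: V|%SET%:R * (#|S :&: V|%SET%:R - 1)) =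
  #|S|%:R * (#|S|%:R - 1) * (x%:R * (x%:R - 1)) / (n%:R * (n%:R - 1)).
Proof.
move=> xn; transitivity (vset_mean x (fun V =>
    \sum_(u in S) \sum_(v in S | v != u) (u \in V)%:R * (v \in V)%:R)).
  apply: eq_vset_mean => V _; rewrite mulrBr mulr1 !card_setI_sum mulr_suml -sumrB.
  apply: eq_bigr => u uS; rewrite mulr_sumr (bigD1 u)//= -natrM mulnb andbb.
  by rewrite [LHS]addrC addrA [- _ + _]addrC subrr add0r.
rewrite /vset_mean exchange_big mulr_sumr /=.
transitivity (\sum_(u in S) ((#|S|%:R - 1) * (x%:R * (x%:R - 1) / (n%:R * (n%:R - 1))) : R)).
  apply: eq_bigr => u uS; rewrite exchange_big mulr_sumr /=.
  transitivity (\sum_(v in S | v != u) (x%:R * (x%:R - 1) / (n%:R * (n%:R - 1)) : R)).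
    apply: eq_bigr => v /andP[_ vu].
    by rewrite -/(vset_mean x (fun V => (u \in V)%:R * (v \in V)%:R)) vset_mean_in2// eq_sym.
  rewrite sumr_const -[LHS]mulr_natl; congr (_ * _).
  rewrite [#|S|](cardD1 u) uS natrD addrC addKr; congr _%:R.
  by apply: eq_card => v; rewrite !inE andbC.
by rewrite sumr_const -[LHS]mulr_natl; ring.
Qed.

End community_weights.

(** * Probability that a community of given size has no edge leaving a set *)

Section cut_bounds.
Variables (R : realType) (n : nat).
Implicit Types (x : nat) (q : R) (S V : {set 'I_n}) (g : community n).

Lemma h_ge0 x q : 0 <= q <= 1 -> 0 <= h x q.
Proof. by move=> /andP[q0 q1]; rewrite subr_ge0 exprn_ile1 ?subr_ge0// gerBl. Qed.

Lemma h_small x q : (x < 2)%N -> h x q = 0.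
Proof. by case: x => [|[|//]] _; rewrite /h expr0 subrr. Qed.

Lemma h_ge x q : (2 <= x)%N -> 0 <= q <= 1 -> q <= h x q.
Proof.
case: x => [|[|x]]// _ /andP[q0 q1]; rewrite /h lerBrDr addrC -lerBrDr.
by rewrite subSS subn0 exprS ler_piMr ?subr_ge0// exprn_ile1 ?subr_ge0// gerBl.
Qed.

Lemma h_le x y q : (x <= y)%N -> 0 <= q <= 1 -> h x q <= h y q.
Proof.
move=> xy /andP[q0 q1]; rewrite lerD2l lerN2.
by rewrite ler_wiXn2l ?subr_ge0// ?gerBl// leq_sub2r.
Qed.

Lemma uncut_pmf x q S :
  \sum_(g : community n | [disjoint g.2 & edge_cut S]) community_pmf x q g =
  vset_mean x (fun V => (1 - q) ^+ (#|S :&: V|%SET * (x - #|S :&: V|%SET))).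
Proof.
have /= -> := sum_community_pmf x q predT (edge_cut S); congr (_ * _).
by apply: eq_bigr => V /eqP Vx; rewrite card_pairs_cut Vx.
Qed.

(** The factor a - a (a - 1) is 0 at a = 0 and 1 at a = 1, with equality in both cases; it is
    nonpositive for a >= 2, where the right-hand side is at least 1. *)
Lemma h_first_moment_le x q (a : nat) : 0 <= q <= 1 ->
  (1 - q) ^+ (a * (x - a)) <= 1 - h x q * (a%:R - a%:R * (a%:R - 1)).
Proof.
move=> q01; have h0 := h_ge0 x q01; move/andP : q01 => [q0 q1].
have p1 k : (1 - q) ^+ k <= 1 by rewrite exprn_ile1 ?subr_ge0// gerBl.
case: a => [|[|a]].
- by rewrite mul0n expr0 mul0r subrr mulr0 subr0.
- by rewrite mul1n subrr mulr0 subr0 mulr1 /h subKr.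
- apply: le_trans (p1 _) _; rewrite lerDl oppr_ge0 mulr_ge0_le0//.
  by rewrite -[X in X - _]mulr1 -mulrBr mulr_ge0_le0// opprB addrC -natr1 addrK subr_le0 ler1n.
Qed.

(** If a (x - a) is positive, the left-hand side is at most 1 - q, while a (x - a) <= x^2. *)
Lemma q_second_moment_le x q (a : nat) : (2 <= x)%N -> (a <= x)%N -> 0 <= q <= 1 ->
  (1 - q) ^+ (a * (x - a)) <= 1 - q / x%:R ^+ 2 * (a * (x - a))%:R.
Proof.
move=> x2 ax /andP[q0 q1].
have x0 : 0 < x%:R ^+ 2 :> R by rewrite exprn_gt0// ltr0n (leq_trans _ x2).
have [->|] := posnP (a * (x - a)); first by rewrite expr0 mulr0 subr0.
move=> ax0; apply: (@le_trans _ _ (1 - q)).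
  by rewrite -[leRHS]expr1 ler_wiXn2l ?subr_ge0// gerBl.
rewrite lerD2l lerN2 mulrAC ler_pdivrMr// ler_wpM2l//.
by rewrite -natrX ler_nat -mulnn leq_mul// leq_subr.
Qed.

(** Averaging [h_first_moment_le] produces k x / n minus the second factorial moment, where k =
    [#|S|], and the latter is at most (k x / n)^2. *)
Lemma uncut_pmf_le x q S : (0 < n)%N -> (x <= n)%N -> 0 <= q <= 1 ->
  \sum_(g : community n | [disjoint g.2 & edge_cut S]) community_pmf x q g <=
  1 - #|S|%:R / n%:R * (x%:R * h x q) * (1 - #|S|%:R * x%:R / n%:R).
Proof.
move=> n0 xn q01; rewrite uncut_pmf.
have Sn : (#|S| <= n)%N by rewrite -[leqRHS]card_ord max_card.
apply: (@le_trans _ _ (vset_mean x (fun V => 1 + (- h x q) *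
    (#|S :&: V|%SET%:R + (-1) * (#|S :&: V|%SET%:R * (#|S :&: V|%SET%:R - 1)))))).
  by apply: ler_vset_mean => V _; rewrite mulN1r mulNr; exact: h_first_moment_le.
rewrite vset_meanD vset_mean1// vset_meanZ vset_meanD vset_meanZ.
rewrite vset_mean_card// vset_mean_card2//.
rewrite mulNr lerD2l lerN2 mulN1r.
set k : R := #|S|%:R; set y : R := x%:R; set N : R := n%:R.
have N0 : 0 < N by rewrite ltr0n.
have -> : k / N * (y * h x q) * (1 - k * y / N) =
    h x q * (k * y / N - (k * y / N) * (k * y / N)) by ring.
apply: ler_wpM2l; first exact: h_ge0.
rewrite lerD2l lerN2.
(* For [n = 1] the factor n - 1 is 0 and so is its inverse: the second moment term vanishes. *)
have [n1|n1] := leqP n 1.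
  suff -> : N = 1 by rewrite subrr mulr0 invr0 mulr0 mulr_ge0// divr_ge0// ?mulr_ge0.
  by rewrite /N (_ : n = 1%N)//; apply/eqP; rewrite eqn_leq n1.
have N1 : 0 < N - 1 by rewrite subr_gt0 ltr1n.
have [x0|y1] := posnP x; first by rewrite /y x0 !(mulr0, mul0r).
have k0 : 0 <= k by [].
have y0 : 0 <= y by [].
have kN : k <= N by rewrite ler_nat.
rewrite ler_pdivrMr ?mulr_gt0//.
have -> : k * y / N * (k * y / N) * (N * (N - 1)) = (k * y) * ((k * y) * (1 - N^-1)).
  by field; rewrite gt_eqF.
have -> : k * (k - 1) * (y * (y - 1)) = (k * y) * ((k - 1) * (y - 1)) by ring.
apply: ler_wpM2l; first exact: mulr_ge0.
(* This uses k <= n; it then remains to bound y - 1 by y. *)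
have Nk : k * (1 - N^-1) >= k - 1.
  by rewrite mulrBr mulr1 lerD2l lerN2 ler_pdivrMr// mul1r.
have {}y1 : 1 <= y by rewrite ler1n.
rewrite [leRHS]mulrAC; apply: (@le_trans _ _ (k * (1 - N^-1) * (y - 1))).
  by rewrite ler_wpM2r ?subr_ge0.
apply: ler_wpM2l; last by rewrite gerBl.
by rewrite mulr_ge0// subr_ge0 invf_le1// ler1n.
Qed.

(** The constant 4 comes from two factors that are at least 1/2: 1 - 1/x, as x >= 2, and (n - |S|) /
    (n - 1), as 2 |S| <= n. *)
Lemma uncut_pmf_le_ge2 x q S : (2 <= x <= n)%N -> (2 * #|S| <= n)%N -> 0 <= q <= 1 ->
  \sum_(g : community n | [disjoint g.2 & edge_cut S]) community_pmf x q g <=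
  1 - q / 4 * (#|S|%:R / n%:R).
Proof.
move=> /andP[x2 xn] Sn2 q01; rewrite uncut_pmf.
have n2 : (2 <= n)%N := leq_trans x2 xn.
have q0 : 0 <= q by case/andP : q01.
set k : R := #|S|%:R; set y : R := x%:R; set N : R := n%:R.
(* The product a (x - a) is written (x - 1) a - a (a - 1), so that only factorial moments occur. *)
apply: (@le_trans _ _ (vset_mean x (fun V => 1 + (- (q / y ^+ 2)) *
   ((y - 1) * #|S :&: V|%SET%:R + (-1) * (#|S :&: V|%SET%:R * (#|S :&: V|%SET%:R - 1)))))).
  apply: ler_vset_mean => V Vx.
  have ax : (#|S :&: V|%SET <= x)%N by rewrite -Vx subset_leq_card// finset.subsetIr.
  apply: le_trans (q_second_moment_le x2 ax q01) _.
  by rewrite natrM natrB// -/y le_eqVlt; apply/orP; left; apply/eqP; ring.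
rewrite vset_meanD vset_mean1// vset_meanZ vset_meanD !vset_meanZ.
rewrite vset_mean_card// vset_mean_card2// -/k -/y -/N.
have N2 : 2 <= N by rewrite ler_nat.
have y2 : 2 <= y by rewrite ler_nat.
have k0 : 0 <= k by [].
have kN : 2 * k <= N by rewrite -natrM ler_nat.
have N0 : 0 < N by lra.
have N1 : 0 < N - 1 by lra.
have y0 : 0 < y by lra.
have -> : (y - 1) * (k * y / N) + -1 * (k * (k - 1) * (y * (y - 1)) / (N * (N - 1))) =
   y * (y - 1) * ((k / N) * ((N - k) / (N - 1))).
  by field; rewrite !gt_eqF.
have -> : - (q / y ^+ 2) * (y * (y - 1) * (k / N * ((N - k) / (N - 1)))) =
   - (q * ((k / N) * ((1 - y^-1) * ((N - k) / (N - 1))))).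
  by field; rewrite !gt_eqF.
rewrite lerD2l lerN2 -mulrA ler_wpM2l//.
rewrite mulrC ler_wpM2l//; first by rewrite divr_ge0// ltW.
have y12 : 2^-1 <= 1 - y^-1.
  have : y^-1 <= 2^-1 by rewrite lef_pV2// posrE.
  lra.
have N12 : 2^-1 <= (N - k) / (N - 1) by rewrite ler_pdivlMr//; lra.
apply: (@le_trans _ _ (2^-1 * 2^-1)); first by lra.
by rewrite ler_pM// invr_ge0.
Qed.

(** An equality, since the vertex is either outside the community or a member with x - 1 possible
    links. *)
Lemma uncut_pmf1 x q v : (x <= n)%N ->
  \sum_(g : community n | [disjoint g.2 & edge_cut [set v]%SET]) community_pmf x q g =
  1 - x%:R * h x q / n%:R.
Proof.
move=> xn; rewrite uncut_pmf.
transitivity (vset_mean x (fun V => 1 + (- h x q) * (v \in V)%:R)).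
  apply: eq_vset_mean => V _; have [vV|vV] := boolP (v \in V).
    have -> : ([set v] :&: V = [set v])%SET by apply/finset.setIidPl; rewrite finset.sub1set.
    by rewrite cards1 mul1n mulr1 /h subKr.
  have -> : ([set v] :&: V = finset.set0)%SET.
    by apply/eqP; rewrite setI_eq0 finset.disjoints_subset finset.sub1set inE.
  by rewrite cards0 mul0n expr0 mulr0 addr0.
rewrite vset_meanD vset_mean1// vset_meanZ vset_mean_in//.
by rewrite mulNr mulrA (mulrC (h _ _)).
Qed.

Lemma community_pmf_uncut x q g v : v \notin g.1 ->
  ~~ [disjoint g.2 & edge_cut [set v]%SET] -> community_pmf x q g = 0.
Proof.
move=> vg /existsP[f /andP[/= fg /cutP[a [b [fab]]]]].
rewrite inE => /eqP av _; rewrite /community_pmf; case: ifP => // /andP[_ /fintype.subsetP gp].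
have := gp _ fg; rewrite inE powersetE => /andP[/fintype.subsetP fV _].
by move: vg; rewrite fV// fab av !inE eqxx.
Qed.

Lemma sum_community_pmf_vset x q (A : pred {set 'I_n}) :
  \sum_(g : community n | A g.1) community_pmf x q g = vset_mean x (fun V => (A V)%:R).
Proof.
transitivity (\sum_(g : community n | A g.1 && [disjoint g.2 & finset.set0])
   community_pmf x q g).
  by apply: eq_bigl => g; rewrite disjoint_sym finset.disjoints_subset finset.sub0set andbT.
rewrite sum_community_pmf; congr (_ * _).
rewrite big_mkcondl; apply: eq_bigr => V _.
by rewrite finset.setI0 cards0 expr0; case: (A V).
Qed.

Lemma sum_community_pmf1 x q : (x <= n)%N ->
  \sum_(g : community n) community_pmf x q g = 1.
Proof. by move=> xn; have /= -> := sum_community_pmf_vset x q predT; rewrite vset_mean1. Qed.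

Lemma sum_community_pmf_le1 x q (p : pred (community n)) :
  (x <= n)%N -> 0 <= q <= 1 -> \sum_(g | p g) community_pmf x q g <= 1.
Proof.
move=> xn q01; rewrite -(sum_community_pmf1 q xn) [leRHS](bigID p) /= lerDl.
by apply: sumr_ge0 => g _; exact: community_pmf_ge0.
Qed.

Lemma community_pmf_le1 x q g : (x <= n)%N -> 0 <= q <= 1 -> community_pmf x q g <= 1.
Proof.
move=> xn q01; have := sum_community_pmf_le1 (pred1 g) xn q01.
by rewrite big_pred1_eq.
Qed.

(** Inclusion-exclusion on the events that [u] and [v] have an edge in the community. If both have
    one, both are members and [u] has an edge; this has probability h x (x - 1) / (n (n - 1)), at
    most x^2 h / n^2 because x <= n. *)
Lemma uncut_pmf2_le x q u v : (x <= n)%N -> 0 <= q <= 1 -> u != v ->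
  \sum_(g : community n | [disjoint g.2 & edge_cut [set u]%SET] && [disjoint g.2 & edge_cut [set v]%SET])
    community_pmf x q g <=
  1 - 2 * (x%:R * h x q / n%:R) + (x%:R ^+ 2 * h x q) / n%:R ^+ 2.
Proof.
move=> xn q01 uv; have h0 := h_ge0 x q01.
pose D (w : 'I_n) g := [disjoint g.2 & edge_cut [set w]%SET].
pose A (V : {set 'I_n}) := (u \in V) && (v \in V).
pose f g := community_pmf x q g.
pose s (p : pred (community n)) := \sum_(g | p g) f g.
have f0 g : 0 <= f g by exact: community_pmf_ge0.
have sD w : s (D w) = 1 - x%:R * h x q / n%:R by exact: uncut_pmf1.
have split_s (p r : pred (community n)) :
  s p = s (fun g => p g && r g) + s (fun g => p g && ~~ r g) by exact: bigID.
have total : s predT = 1 by exact: sum_community_pmf1.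
(* A vertex with an edge in the community is a member, except in communities of weight 0. *)
have nuv : s (fun g => ~~ D v g && ~~ D u g) <= s (fun g => A g.1 && ~~ D u g).
  rewrite /s [leLHS]big_mkcond [leRHS]big_mkcond; apply: ler_sum => g _.
  have [Dv|Dv] /= := boolP (D v g); first by case: ifP.
  have [Du|Du] /= := boolP (D u g); first by rewrite andbF.
  rewrite andbT; case: ifP => // /negbT; rewrite negb_and => /orP[] ng.
    by rewrite /f (community_pmf_uncut x q ng Du).
  by rewrite /f (community_pmf_uncut x q ng Dv).
have sA : s (fun g => A g.1) = x%:R * (x%:R - 1) / (n%:R * (n%:R - 1)).
  rewrite /s sum_community_pmf_vset -(vset_mean_in2 _ xn uv).
  by apply: eq_vset_mean => V _; rewrite -natrM mulnb.
have sAu : s (fun g => A g.1 && D u g) =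
    (1 - h x q) * (x%:R * (x%:R - 1) / (n%:R * (n%:R - 1))).
  rewrite /s sum_community_pmf -(vset_mean_in2 _ xn uv) -vset_meanZ /vset_mean.
  congr (_ * _); rewrite big_mkcondl; apply: eq_bigr => V /eqP Vx.
  rewrite -natrM mulnb -/(A V); case: ifP => [|_]; last by rewrite mulr0.
  move=> /andP[uV _]; rewrite card_pairs_cut Vx.
  have -> : ([set u] :&: V = [set u])%SET by apply/finset.setIidPl; rewrite finset.sub1set.
  by rewrite cards1 mul1n mulr1 /h subKr.
have := split_s (D u) (D v); have := split_s predT (D v).
have := split_s (fun g => ~~ D v g) (D u); have := split_s (fun g => A g.1) (D u).
rewrite total !sD sA sAu -/(s _) /= => e1 e2 e3 e4.
have e5 : s (fun g => ~~ D v g && D u g) = s (fun g => D u g && ~~ D v g).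
  by apply: eq_bigl => g; rewrite andbC.
have bound : h x q * (x%:R * (x%:R - 1) / (n%:R * (n%:R - 1))) <=
    (x%:R ^+ 2 * h x q) / n%:R ^+ 2.
  rewrite [leRHS]mulrAC [leRHS]mulrC ler_wpM2l//.
  have n1 : (1 < n)%N by have := max_card [set u; v]%SET; rewrite cards2 uv card_ord.
  have N1 : 1 < n%:R :> R by rewrite ltr1n.
  have xN : x%:R <= n%:R :> R by rewrite ler_nat.
  have x0 : 0 <= x%:R :> R by [].
  have NN : 0 < n%:R * (n%:R - 1) :> R by rewrite mulr_gt0; lra.
  rewrite ler_pdivrMr// mulrAC ler_pdivlMr ?exprn_gt0//; last lra.
  have : 0 <= x%:R * n%:R * (n%:R - x%:R) :> R.
    by rewrite !mulr_ge0// subr_ge0.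
  lra.
change (s (fun g => D u g && D v g) <= 1 - 2 * (x%:R * h x q / n%:R) +
   (x%:R ^+ 2 * h x q) / n%:R ^+ 2).
lra.
Qed.

End cut_bounds.

(** * Finite families of independent communities *)

Section independent_communities.
Variables (R : realType) (n m : nat) (mu : community n -> R).
Hypotheses (mu0 : forall g, 0 <= mu g) (mu1 : \sum_g mu g = 1).
Implicit Types (g : {ffun 'I_m -> community n}) (S : {set 'I_n}).

(** The probability of [p] for [m] independent communities of law [mu]. *)
Definition family_weight (p : pred {ffun 'I_m -> community n}) : R :=
  \sum_(g | p g) \prod_i mu (g i).

Definition uncut_weight S : R := \sum_(c : community n | [disjoint c.2 & edge_cut S]) mu c.

Lemma family_weight_ge0 p : 0 <= family_weight p.
Proof. by apply: sumr_ge0 => g _; apply: prodr_ge0. Qed.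

Lemma family_weight_forall (B : pred (community n)) :
  family_weight (fun g => [forall i, B (g i)]) = (\sum_(c | B c) mu c) ^+ m.
Proof.
rewrite -[X in _ ^+ X]card_ord -prodr_const bigA_distr_big.
by apply: eq_bigl => g; apply/forallP/ffun_onP.
Qed.

Lemma family_weightT : family_weight predT = 1.
Proof.
have := family_weight_forall predT; rewrite mu1 expr1n => <-.
by apply: eq_bigl => g; apply/esym/forallP.
Qed.

Lemma family_weightC p : family_weight p = 1 - family_weight (fun g => ~~ p g).
Proof. by rewrite -family_weightT [family_weight predT](bigID p) /= addrK. Qed.

(** Union bound over the sets given by [disconnected_cut]. For a fixed [S], the union of the
    communities has no edge leaving [S] exactly when no community has one, whence the power [m]. *)
Lemma family_weight_disconnected_le :
  family_weight (fun g => ~~ connected_graph (affiliation_graph g)) <=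
  \sum_(S : {set 'I_n} | (0 < #|S|)%N && (2 * #|S| <= n)%N) uncut_weight S ^+ m.
Proof.
pose w (g : {ffun 'I_m -> community n}) := \prod_i mu (g i).
pose I S g := [forall i, [disjoint (g i : community n).2 & edge_cut S]].
have -> : \sum_(S : {set 'I_n} | (0 < #|S|)%N && (2 * #|S| <= n)%N) uncut_weight S ^+ m =
    \sum_(S : {set 'I_n} | (0 < #|S|)%N && (2 * #|S| <= n)%N) \sum_g w g * (I S g)%:R.
  apply: eq_bigr => S _; rewrite -family_weight_forall /family_weight big_mkcond.
  by apply: eq_bigr => g _; rewrite -/(I S g); case: (I S g); rewrite ?mulr1 ?mulr0.
rewrite exchange_big /= /family_weight [leLHS]big_mkcond; apply: ler_sum => g _.
have w0 : 0 <= w g by exact: prodr_ge0.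
case: ifP => [/disconnected_cut[S [S0 Sn]]|_].
  rewrite affiliation_disjoint => gS; rewrite (bigD1 S) ?S0//= /I gS mulr1.
  by rewrite lerDl sumr_ge0// => S' _; rewrite mulr_ge0.
by rewrite sumr_ge0// => S' _; rewrite mulr_ge0.
Qed.

(** Second moment method. Let N be the number of isolated vertices, of mean [EN]. A connected graph
    has N = 0, so (N - [EN])^2 equals [EN]^2 there, and the left-hand side is at most the variance
    of N. *)
Lemma family_weight_connected_le (p p2 : R) : (1 < n)%N -> 0 <= p2 ->
  (forall v, uncut_weight [set v]%SET = p) ->
  (forall u v, u != v -> \sum_(c : community n | [disjoint c.2 & edge_cut [set u]%SET] &&
     [disjoint c.2 & edge_cut [set v]%SET]) mu c <= p2) ->
  family_weight (fun g => connected_graph (affiliation_graph g)) * (n%:R * p ^+ m) ^+ 2 <=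
  n%:R * p ^+ m + n%:R ^+ 2 * p2 ^+ m - (n%:R * p ^+ m) ^+ 2.
Proof.
move=> n1 p20 pE p2E.
pose w g := \prod_i mu (g i).
have w0 g : 0 <= w g by exact: prodr_ge0.
pose I v g := [forall i, [disjoint (g i).2 & edge_cut [set v]%SET]].
pose N g : R := \sum_v (I v g)%:R.
set EN := n%:R * p ^+ m.
have wN : \sum_g w g * N g = EN.
  under eq_bigr do rewrite mulr_sumr.
  rewrite exchange_big /=.
  transitivity (\sum_(v < n) p ^+ m); last by rewrite sumr_const card_ord -[LHS]mulr_natl.
  apply: eq_bigr => v _; rewrite -(pE v) /uncut_weight -family_weight_forall.
  rewrite /family_weight [RHS]big_mkcond; apply: eq_bigr => g _.
  by rewrite -/(I v g) -/(w g); case: (I v g); rewrite ?mulr1 ?mulr0.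
have wN2 : \sum_g w g * N g ^+ 2 <= EN + n%:R ^+ 2 * p2 ^+ m.
  have -> : \sum_g w g * N g ^+ 2 =
      \sum_u \sum_v family_weight (fun g => I u g && I v g).
    under eq_bigr do rewrite expr2 mulr_suml mulr_sumr.
    rewrite exchange_big /=; apply: eq_bigr => u _.
    under eq_bigr do rewrite mulr_sumr mulr_sumr.
    rewrite exchange_big /=; apply: eq_bigr => v _.
    rewrite /family_weight [RHS]big_mkcond; apply: eq_bigr => g _.
    by rewrite -natrM mulnb; case: (_ && _); rewrite ?mulr1 ?mulr0.
  have I2 u v : family_weight (fun g => I u g && I v g) =
      (\sum_(c : community n | [disjoint c.2 & edge_cut [set u]%SET] && [disjoint c.2 & edge_cut [set v]%SET]) mu c) ^+ m.
    rewrite -family_weight_forall; apply: eq_bigl => g.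
    apply/andP/forallP => [[/forallP Iu /forallP Iv] i|Iuv]; first by rewrite Iu Iv.
    by split; apply/forallP => i; have /andP[] := Iuv i.
  have -> : EN + n%:R ^+ 2 * p2 ^+ m = \sum_(u < n) (p ^+ m + \sum_(v < n) p2 ^+ m).
    by rewrite !sumr_const !card_ord -[RHS]mulr_natl -[p2 ^+ m *+ n]mulr_natl /EN; ring.
  apply: ler_sum => u _; rewrite (bigD1 u)//= lerD//.
    rewrite I2 -(pE u) /uncut_weight.
    by under eq_bigl do rewrite andbb.
  (* The right-hand sum also runs over [v = u]; this extra term is nonnegative and is dropped. *)
  rewrite [leRHS](bigD1 u)//= -[leLHS]add0r lerD ?exprn_ge0//.
  apply: ler_sum => v vu; rewrite I2 lerXn2r ?nnegrE ?sumr_ge0//.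
  by apply: p2E; rewrite eq_sym.
apply: (@le_trans _ _ (\sum_g w g * (N g - EN) ^+ 2)).
  rewrite /family_weight mulr_suml [leLHS]big_mkcond; apply: ler_sum => g _.
  case: ifP => [cg|_]; last by rewrite mulr_ge0// sqr_ge0.
  suff -> : N g = 0 by rewrite sub0r sqrrN.
  apply: big1 => v _; have [Iv|//] := boolP (I v g); exfalso.
  move: Iv; rewrite /I -affiliation_disjoint => /isolated_disconnected -/(_ n1).
  by rewrite cg.
have w1 : \sum_g w g = 1 by exact: family_weightT.
have -> : \sum_g w g * (N g - EN) ^+ 2 = \sum_g w g * N g ^+ 2 - EN ^+ 2.
  transitivity (\sum_g (w g * N g ^+ 2 + (w g * N g * (- 2 * EN) + w g * EN ^+ 2))).
    by apply: eq_bigr => g _; ring.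
  rewrite !big_split /= -!mulr_suml wN w1; ring.
by rewrite lerD2r.
Qed.

End independent_communities.

Local Open Scope classical_set_scope.
Local Open Scope ring_scope.

(** * Expectations of functions of the generic pair *)

Section generic_pair.
Context (R : realType) (d : measure_display) (Omega : measurableType d)
  (P : probability Omega R) (X : {RV P >-> nat}) (Q : {RV P >-> R}).
Hypothesis Q01 : forall w, 0 <= Q w <= 1.
Implicit Types (f g : nat -> R -> R).

(** Real-valued, an infinite integral being sent to 0; the linear rules below therefore ask for
    [integ]. *)
Definition mean f : R := \int[P]_w f (X w) (Q w).

Definition integ f : Prop := P.-integrable setT (EFin \o (fun w => f (X w) (Q w))).

(** As [nat] is countable and discrete, a preimage splits into countably many pieces on which [u] is
    constant. *)
Lemma measurable_nat_pair d' (T : measurableType d') (u : T -> nat) (v : T -> R)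
    (f : nat -> R -> R) :
  measurable_fun setT u -> measurable_fun setT v ->
  (forall x, measurable_fun setT (f x)) -> measurable_fun setT (fun w => f (u w) (v w)).
Proof.
move=> mu mv mf _ B mB; rewrite setTI.
have -> : (fun w => f (u w) (v w)) @^-1` B =
    \bigcup_x (u @^-1` [set x] `&` (fun w => f x (v w)) @^-1` B).
  by apply/seteqP; split => [w Bw|w [x _ [/= <- //]]]; exists (u w).
apply: bigcupT_measurable => x; apply: measurableI.
  by rewrite -[X in measurable X]setTI; exact: mu.
rewrite -[X in measurable X]setTI.
by apply: (measurableT_comp (mf x) mv).
Qed.

Lemma measurable_pairfun f : (forall x, measurable_fun setT (f x)) ->
  measurable_fun setT (fun w => f (X w) (Q w)).
Proof. by move=> mf; apply: measurable_nat_pair. Qed.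

Lemma integ_le f g : (forall x, measurable_fun setT (f x)) ->
  (forall x q, 0 <= q <= 1 -> `|f x q| <= g x q) -> integ g -> integ f.
Proof.
move=> mf fg; apply: le_integrable => //.
  by apply/measurable_EFinP; exact: measurable_pairfun.
move=> w _ /=; rewrite lee_fin; apply: le_trans (fg _ _ (Q01 w)) _.
exact: ler_norm.
Qed.

Lemma integ_cst c : integ (fun _ _ => c).
Proof. exact: finite_measure_integrable_cst. Qed.

Lemma integ_bounded f M : (forall x, measurable_fun setT (f x)) ->
  (forall x q, 0 <= q <= 1 -> `|f x q| <= M) -> integ f.
Proof. by move=> mf fM; apply: (integ_le (g := fun _ _ => M)) => //; exact: integ_cst. Qed.

Lemma integD f g : integ f -> integ g -> integ (fun x q => f x q + g x q).
Proof. by move=> fi gi; exact: (integrableD measurableT fi gi). Qed.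

Lemma integZ c f : integ f -> integ (fun x q => c * f x q).
Proof. by move=> fi; exact: (integrableZl measurableT c fi). Qed.

Lemma mean_cst c : mean (fun _ _ => c) = c.
Proof.
by rewrite /mean Rintegral_cst// [X in fine X](_ : _ = 1%E) ?mulr1//; exact: probability_setT.
Qed.

Lemma meanD f g : integ f -> integ g -> mean (fun x q => f x q + g x q) = mean f + mean g.
Proof. by move=> fi gi; exact: RintegralD. Qed.

Lemma meanZ c f : integ f -> mean (fun x q => c * f x q) = c * mean f.
Proof. by move=> fi; exact: RintegralZl. Qed.

Lemma mean_le f g : integ f -> integ g ->
  (forall x q, 0 <= q <= 1 -> f x q <= g x q) -> mean f <= mean g.
Proof. by move=> fi gi fg; apply: le_Rintegral => // w _; exact: fg. Qed.

Lemma mean_ge0 f : (forall x q, 0 <= q <= 1 -> 0 <= f x q) -> 0 <= mean f.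
Proof. by move=> f0; apply: Rintegral_ge0 => w _; exact: f0. Qed.

Lemma measurable_h x : measurable_fun setT (@h R x).
Proof.
by apply: measurable_funB => //; apply: measurable_funX; apply: measurable_funB.
Qed.

Lemma measurable_community_pmf n x (g : community n) :
  measurable_fun setT (fun q : R => community_pmf x q g).
Proof.
rewrite /community_pmf; case: (_ && _) => //.
apply: measurable_funM => //.
have -> : (fun q : R => \prod_(f in pairs g.1) (if f \in g.2 then q else 1 - q)) =
  (fun q : R => \prod_f (if f \in pairs g.1 then (if f \in g.2 then q else 1 - q) else 1)).
  by apply/funext => q; rewrite big_mkcond.
apply: measurable_prod => f _; case: (f \in pairs g.1) => //; case: (f \in g.2) => //.
exact: measurable_funB.
Qed.

Lemma integ_community_pmf n (g : community n) :
  integ (fun x q => community_pmf (minn x n) q g).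
Proof.
apply: (integ_bounded (M := 1)) => [x|x q q01].
  exact: measurable_community_pmf.
by rewrite ger0_norm ?community_pmf_ge0// community_pmf_le1// geq_minr.
Qed.

(** The unconditional law of one community, its size being truncated at [n]. *)
Definition law n (g : community n) : R := mean (fun x q => community_pmf (minn x n) q g).

Lemma sum_law n (p : pred (community n)) :
  \sum_(g | p g) law g = mean (fun x q => \sum_(g | p g) community_pmf (minn x n) q g).
Proof.
rewrite /law /mean /Rintegral.
have fin (g : community n) :
   (\int[P]_w (community_pmf (minn (X w) n) (Q w) g)%:E)%E \is a fin_num.
  by apply: integrable_fin_num => //; exact: integ_community_pmf.
under eq_integral do rewrite -sumEFin -big_filter.
rewrite ge0_integral_sum//; first last.
- by move=> g w _; rewrite lee_fin community_pmf_ge0.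
- move=> g; apply/measurable_EFinP.
  by apply: (measurable_pairfun (f := fun x q => community_pmf (minn x n) q g)) => x; exact: measurable_community_pmf.
rewrite big_filter sum_fine//.
Qed.

Lemma law_ge0 n (g : community n) : 0 <= law g.
Proof. by apply: mean_ge0 => x q q01; exact: community_pmf_ge0. Qed.

Lemma law1 n : \sum_(g : community n) law g = 1.
Proof.
rewrite sum_law -[RHS](mean_cst 1); congr mean; apply/funext => x; apply/funext => q.
by rewrite sum_community_pmf1 ?geq_minr.
Qed.

(** * Integrability and tails of X h(X,Q) *)

Definition xh x q : R := x%:R * h x q.

Lemma xh_ge0 x q : 0 <= q <= 1 -> 0 <= xh x q.
Proof. by move=> q01; rewrite mulr_ge0 ?h_ge0. Qed.

Lemma xhM_ge0 x q c : 0 <= q <= 1 -> 0 <= c -> 0 <= xh x q * c.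
Proof. by move=> q01 c0; rewrite mulr_ge0// xh_ge0. Qed.

Lemma measurable_xh x : measurable_fun setT (xh x).
Proof. by apply: measurable_funM => //; exact: measurable_h. Qed.

Lemma xh_minn_le x n q : 0 <= q <= 1 -> xh (minn x n) q <= xh x q.
Proof.
by move=> q01; rewrite ler_pM ?h_ge0// ?ler_nat ?geq_minl// h_le// geq_minl.
Qed.

Hypothesis xh_ln : integ (fun x q => xh x q * ln (1 + x%:R)).

(** For x < 2 the factor h is 0, and for x >= 2 one has ln(1 + x) >= 1/2, so twice the integrand of
    the logarithmic moment dominates. *)
Lemma integ_xh : integ xh.
Proof.
apply: (integ_le (g := fun x q => 2 * (xh x q * ln (1 + x%:R)))).
- exact: measurable_xh.
- move=> x q q01; rewrite ger0_norm ?xh_ge0//.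
  have [x2|x2] := ltnP x 2; first by rewrite /xh h_small// mulr0 !mul0r mulr0.
  rewrite mulrCA ler_peMr ?xh_ge0//.
  (* Follows from 1 - 1/2 <= exp(-1/2). *)
  have e2 : expR (2^-1) <= 2 :> R.
    have := expR_ge1Dx (- 2^-1 : R); rewrite expRN.
    have e0 := expR_gt0 (2^-1 : R).
    rewrite -[(expR _)^-1]mul1r ler_pdivlMr//; lra.
  have : 2^-1 <= ln (1 + x%:R) :> R.
    have x0 : 0 < 1 + x%:R :> R by rewrite ltr_pwDl.
    rewrite -[leLHS]expRK ler_ln ?posrE ?expR_gt0//.
    apply: le_trans e2 _; have : 2 <= x%:R :> R by rewrite ler_nat.
    lra.
  lra.
- exact: integZ.
Qed.

Definition tail (T : R) : R := mean (fun x q => xh x q * (T < x%:R)%R%:R).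

Lemma integ_xh_bool (b : nat -> bool) : integ (fun x q => xh x q * (b x)%:R).
Proof.
apply: (integ_le (g := xh)); last exact: integ_xh.
- by move=> x; apply: measurable_funM => //; exact: measurable_xh.
- move=> x q q01; rewrite ger0_norm ?xhM_ge0//.
  by case: (b x); rewrite ?mulr1// mulr0 xh_ge0.
Qed.

Lemma mean_xh_le (T : R) :
  mean (fun x q => xh x q * (x%:R <= T)%R%:R) = mean xh - tail T.
Proof.
apply/eqP; rewrite eq_sym subr_eq -meanD; try exact: integ_xh_bool.
apply/eqP; congr mean; apply/funext => x; apply/funext => q.
by rewrite -mulrDr; case: leP => _; rewrite ?addr0 ?add0r mulr1.
Qed.

Lemma tail_ge0 T : 0 <= tail T.
Proof. by apply: mean_ge0 => x q q01; exact: xhM_ge0. Qed.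

Lemma tail_le T : tail T <= mean xh.
Proof.
rewrite -subr_ge0 -mean_xh_le; apply: mean_ge0 => x q q01.
by rewrite xhM_ge0.
Qed.

(** On the event X > T one has ln(1 + T) <= ln(1 + X), so the product is at most the part of the
    logarithmic moment carried by X > T, which tends to 0 by dominated convergence. *)
Lemma tail_ln_cvg (T : nat -> R) : T n @[n --> \oo] --> +oo ->
  (tail (T n) * ln (1 + T n) @[n --> \oo] --> (0 : R)).
Proof.
move=> Toy.
pose F (t : R) x q : R := xh x q * ln (1 + x%:R) * (t < x%:R)%R%:R.
have mF t x : measurable_fun setT (F t x).
  by do 2![apply: measurable_funM => //]; exact: measurable_xh.
have F_ge0 t x q : 0 <= q <= 1 -> 0 <= F t x q.
  by move=> q01; rewrite mulr_ge0// xhM_ge0// ln_ge0// lerDl.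
have F_le t x q : 0 <= q <= 1 -> `|F t x q| <= xh x q * ln (1 + x%:R).
  move=> q01; rewrite ger0_norm ?F_ge0// /F; case: (t < _); rewrite ?mulr1// mulr0.
  by rewrite xhM_ge0// ln_ge0// lerDl.
have iF t : integ (F t) by apply: integ_le xh_ln; [exact: mF | exact: F_le].
have meanF : mean (F (T n)) @[n --> \oo] --> (0 : R).
  rewrite /mean /Rintegral -[0 : R]/(fine 0%E).
  have <- : (\int[P]_w (0 : R)%:E = 0)%E by rewrite integral0.
  have mFn k : measurable_fun setT (fun w => (F (T k) (X w) (Q w))%:E).
    by apply/measurable_EFinP; apply: (@measurable_pairfun (F (T k))); exact: mF.
  have F_cvg : \forall w \ae P, setT w ->
      (F (T k) (X w) (Q w))%:E @[k --> \oo] --> ((0 : R)%:E).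
    apply: aeW => w _; apply: cvg_near_cst; near=> k.
    have XT : (X w)%:R < T k by near: k; exact: (cvgryPgt _).1.
    by rewrite /F ltNge (ltW XT) mulr0.
  have F_dom : \forall w \ae P, forall k, setT w ->
      (`|(F (T k) (X w) (Q w))%:E| <= (xh (X w) (Q w) * ln (1 + (X w)%:R))%:E)%E.
    by apply: aeW => w k _; rewrite lee_fin F_le.
  have [_ _ cvgF] := dominated_convergence measurableT mFn (measurable_cst _) F_cvg xh_ln F_dom.
  apply: fine_cvg; rewrite integral0; move: cvgF; rewrite integral0; exact.
apply: (@squeeze_cvgr _ _ _ _ (fun=> 0) (fun n => mean (F (T n)))) => //; last exact: cvg_cst.
near=> n.
have T0 : 0 < T n by near: n; exact: (cvgryPgt _).1.
rewrite mulr_ge0 ?tail_ge0 ?ln_ge0 ?lerDl ?(ltW T0)//=.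
rewrite mulrC /tail -meanZ; last exact: integ_xh_bool.
apply: mean_le; [apply: integZ; exact: integ_xh_bool|exact: iF|].
move=> x q q01; rewrite mulrCA /F -mulrA ler_wpM2l ?xh_ge0//.
case: ltP => Tx; rewrite ?mulr0// !mulr1 ler_ln ?posrE ?lerD2l ?(ltW Tx)// ltr_pwDl//.
exact: ltW.
Unshelve. all: by end_near. Qed.

(** * Cut probabilities under the unconditional law of one community *)

Lemma integ_uncut n (p : pred (community n)) :
  integ (fun x q => \sum_(g | p g) community_pmf (minn x n) q g).
Proof.
apply: (integ_bounded (M := 1)) => [x|x q q01].
  under eq_fun do rewrite -big_filter.
  by apply: measurable_sum => g; exact: measurable_community_pmf.
rewrite ger0_norm; last by apply: sumr_ge0 => g _; exact: community_pmf_ge0.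
by rewrite sum_community_pmf_le1// geq_minr.
Qed.

Lemma mean_affine c f : integ f -> mean (fun x q => 1 - c * f x q) = 1 - c * mean f.
Proof.
move=> fi; under eq_fun do under eq_fun do rewrite -mulNr.
by rewrite meanD ?mean_cst ?meanZ ?mulNr//; [exact: integ_cst|exact: integZ].
Qed.

Lemma integ_affine c f : integ f -> integ (fun x q => 1 - c * f x q).
Proof.
move=> fi; rewrite (_ : (fun _ _ => _) = fun x q => 1 + - c * f x q).
  by apply: integD; [exact: integ_cst|exact: integZ].
by apply/funext => x; apply/funext => q; rewrite mulNr.
Qed.

(** For X > T the conditional probability is bounded by 1. For X <= T <= n the truncation at [n] has
    no effect, and X is replaced by T in the last factor of [uncut_pmf_le]. *)
Lemma uncut_weight_le n (S : {set 'I_n}) (T : R) : (0 < n)%N -> T <= n%:R ->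
  uncut_weight (@law n) S <=
  1 - #|S|%:R / n%:R * (1 - #|S|%:R * T / n%:R) * (mean xh - tail T).
Proof.
move=> n0 Tn; rewrite /uncut_weight sum_law//.
rewrite -mean_xh_le -mean_affine; last exact: integ_xh_bool.
apply: mean_le; [exact: integ_uncut|apply: integ_affine; exact: integ_xh_bool|].
move=> x q q01; case: (leP x%:R T) => xT; last by rewrite !mulr0 subr0 sum_community_pmf_le1// geq_minr.
have xn : (x <= n)%N by rewrite -(ler_nat R) (le_trans xT).
rewrite (minn_idPl xn) mulr1; apply: le_trans (uncut_pmf_le _ n0 xn q01) _.
rewrite lerD2l lerN2 -/(xh x q) mulrAC; apply: ler_wpM2l.
  by apply: mulr_ge0; [exact: divr_ge0|exact: xh_ge0].
by rewrite lerD2l lerN2 ler_wpM2r ?invr_ge0// ler_wpM2l.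
Qed.

Definition link_mean : R := mean (fun x q => q * (2 <= x)%N%:R).

Lemma integ_link : integ (fun x q => q * (2 <= x)%N%:R).
Proof.
apply: (integ_bounded (M := 1)) => [x|x q /andP[q0 q1]].
  exact: measurable_funM.
by rewrite ger0_norm ?mulr_ge0//; case: (_ <= _)%N; rewrite ?mulr1// mulr0.
Qed.

(** For x >= 2 one has q <= h(x,q) <= x h(x,q). This makes [kappa] positive and controls the ratio
    of the two constants in the supercritical case. *)
Lemma link_mean_le : link_mean <= mean xh.
Proof.
apply: mean_le; [exact: integ_link|exact: integ_xh|] => x q q01.
case: (leqP 2 x) => [|x2]; last by rewrite mulr0 xh_ge0.
case: x => [|x]// x2; rewrite mulr1; apply: le_trans (h_ge x2 q01) _.
by rewrite ler_peMl ?h_ge0// ler1n.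
Qed.

Lemma uncut_weight_le_link n (S : {set 'I_n}) : (2 <= n)%N -> (2 * #|S| <= n)%N ->
  uncut_weight (@law n) S <= 1 - #|S|%:R / n%:R / 4 * link_mean.
Proof.
move=> n2 Sn; rewrite /uncut_weight sum_law//.
rewrite -mean_affine; last exact: integ_link.
apply: mean_le; [exact: integ_uncut|apply: integ_affine; exact: integ_link|].
move=> x q q01; have [x2|x2] := leqP 2 x; last first.
  by rewrite !mulr0 subr0 sum_community_pmf_le1// geq_minr.
apply: le_trans (uncut_pmf_le_ge2 _ Sn q01) _; first by rewrite leq_min x2 n2 geq_minr.
by rewrite mulr1 lerD2l lerN2 le_eqVlt; apply/orP; left; apply/eqP; ring.
Qed.

(** The probability that one community has an edge at a given vertex. *)
Definition degree_prob n : R := mean (fun x q => xh (minn x n) q) / n%:R.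

Lemma integ_xh_minn n : integ (fun x q => xh (minn x n) q).
Proof.
apply: (integ_le (g := xh)); last exact: integ_xh.
  by move=> x; exact: measurable_xh.
by move=> x q q01; rewrite ger0_norm ?xh_ge0// xh_minn_le.
Qed.

Lemma degree_prob_ge0 n : 0 <= degree_prob n.
Proof. by rewrite divr_ge0// mean_ge0// => x q; exact: xh_ge0. Qed.

Lemma degree_prob_le n : degree_prob n <= mean xh / n%:R.
Proof.
rewrite ler_wpM2r ?invr_ge0//; apply: mean_le; [exact: integ_xh_minn|exact: integ_xh|].
by move=> x q; exact: xh_minn_le.
Qed.

Lemma uncut_weight1 n (v : 'I_n) :
  uncut_weight (@law n) [set v]%SET = 1 - degree_prob n.
Proof.
rewrite /uncut_weight sum_law// /degree_prob mulrC -mean_affine; last exact: integ_xh_minn.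
congr mean; apply/funext => x; apply/funext => q.
by rewrite uncut_pmf1 ?geq_minr// mulrC.
Qed.

(** In x^2 h(x,q), taken at the truncated size, one factor x is bounded by T if X <= T and by n
    otherwise. *)
Lemma uncut_weight2_le n (u v : 'I_n) (T : R) : u != v -> 0 <= T ->
  \sum_(c : community n | [disjoint c.2 & edge_cut [set u]%SET] &&
     [disjoint c.2 & edge_cut [set v]%SET]) law c <=
  1 - 2 * degree_prob n + (T * mean xh + n%:R * tail T) / n%:R ^+ 2.
Proof.
move=> uv T0; rewrite sum_law//.
have n0 : 0 < n%:R :> R by rewrite ltr0n (leq_ltn_trans _ (ltn_ord u)).
pose f x q := T * xh x q + n%:R * (xh x q * (T < x%:R)%R%:R).
have fi : integ f.
  by apply: integD; apply: integZ; [exact: integ_xh|exact: integ_xh_bool].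
have -> : 1 - 2 * degree_prob n + (T * mean xh + n%:R * tail T) / n%:R ^+ 2 =
    mean (fun x q => (1 - 2 / n%:R * xh (minn x n) q) + n%:R ^- 2 * f x q).
  rewrite meanD; [|by apply: integ_affine; exact: integ_xh_minn|exact: integZ].
  rewrite mean_affine; last exact: integ_xh_minn.
  rewrite meanZ// meanD; [|exact/integZ/integ_xh|exact/integZ/integ_xh_bool].
  rewrite !meanZ; [|exact: integ_xh_bool|exact: integ_xh].
  by rewrite /degree_prob -/(tail T); ring.
apply: mean_le; [exact: integ_uncut| |].
  by apply: integD; [apply: integ_affine; exact: integ_xh_minn|exact: integZ].
move=> x q q01; apply: le_trans (uncut_pmf2_le _ q01 uv) _; first exact: geq_minr.
rewrite -/(xh _ _) mulrA mulrAC; apply: lerD => //.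
rewrite mulrC ler_wpM2l ?invr_ge0 ?exprn_ge0//.
rewrite expr2 -mulrA -/(xh _ _) /f.
have xm := xh_minn_le x n q01; have xh0 := xh_ge0 (minn x n) q01.
case: (ltP T x%:R) => Tx.
  apply: (@le_trans _ _ (n%:R * xh x q)); last by rewrite mulr1 lerDr mulr_ge0// xh_ge0.
  by apply: ler_pM => //; rewrite ler_nat geq_minr.
rewrite mulr0 mulr0 addr0; apply: ler_pM => //.
by apply: le_trans Tx; rewrite ler_nat geq_minl.
Qed.

End generic_pair.

(** * The law of a family of communities *)

Section communities_law.
Context (R : realType) (d : measure_display) (Omega : measurableType d)
  (P : probability Omega R) (X : nat -> {RV P >-> nat}) (Q : nat -> {RV P >-> R}).
Hypothesis Q01 : forall i w, 0 <= Q i w <= 1.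
Hypothesis XQ_ident : forall (i : nat) (B : set (nat * R)), measurable B ->
  P ((fun w => (X i w, Q i w)) @^-1` B) = P ((fun w => (X 0%N w, Q 0%N w)) @^-1` B).

(** Both sides are integrals against the law of the pair on [nat * R], which is the same for all
    indices. *)
Lemma integral_ident i (f : nat -> R -> R) :
  (forall x, measurable_fun setT (f x)) -> (forall x q, 0 <= f x q) ->
  (\int[P]_w (f (X i w) (Q i w))%:E = \int[P]_w (f (X 0%N w) (Q 0%N w))%:E)%E.
Proof.
move=> mf f0.
pose Z j w := (X j w, Q j w).
have mZ j : measurable_fun setT (Z j) by apply/measurable_fun_pairP.
pose F (p : nat * R) := (f p.1 p.2)%:E.
have mF : measurable_fun setT F.
  by apply/measurable_EFinP; apply: measurable_nat_pair.
have F0 : {in setT, forall p, (0 <= F p)%E} by move=> p _; rewrite lee_fin.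
have push j : (\int[pushforward P (Z j)]_p F p = \int[P]_w F (Z j w))%E.
  by rewrite ge0_integral_pushforward.
by rewrite -(push i) -(push 0%N); apply: eq_measure_integral => B mB _; exact: XQ_ident.
Qed.

Section community_family.
Variables (n m : nat) (G : 'I_m -> Omega -> community n).
Hypothesis G_comm : communities P (fun i w => (minn (X i.+1 w) n, Q i.+1 w)) G.

Lemma community_law i g : P (G i @^-1` [set g]) = (law (X 0%N) (Q 0%N) g)%:E.
Proof.
have [mG _ _ /(_ i setT g measurableT)] := G_comm.
rewrite preimage_setT setTI => ->.
(* [integral_ident] asks for nonnegativity at every real q, while [community_pmf] may be negative
   for q outside [0, 1]. The positive part agrees with it at the values of [Q]. *)
pose f x (q : R) := Num.max (community_pmf (minn x n) q g) 0.
have mf x : measurable_fun setT (f x).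
  by apply: measurable_maxr => //; exact: measurable_community_pmf.
have f0 x q : 0 <= f x q by rewrite /f le_max lexx orbT.
have fE j w : f (X j w) (Q j w) = community_pmf (minn (X j w) n) (Q j w) g.
  by rewrite /f max_l// community_pmf_ge0.
transitivity (\int[P]_w (f (X i.+1 w) (Q i.+1 w))%:E)%E.
  by apply: eq_integral => w _; rewrite fE.
rewrite integral_ident// /law /mean /Rintegral fineK.
  by apply: eq_integral => w _; rewrite fE.
by apply: integrable_fin_num => //; exact: integ_community_pmf.
Qed.

(** The event is a finite disjoint union over the families satisfying [p], and each family has a
    product probability by independence. *)
Lemma family_prob (p : pred {ffun 'I_m -> community n}) :
  P [set w | p [ffun i => G i w]] = (family_weight (@law _ _ _ P (X 0%N) (Q 0%N) n) p)%:E.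
Proof.
have [mG _ indep _] := G_comm.
pose F (g : {ffun 'I_m -> community n}) := \bigcap_i (G i @^-1` [set g i]).
have mGi i c : measurable (G i @^-1` [set c]).
  by rewrite -[X in measurable X]setTI; apply: (mG i).2.
have FE g : P (F g) = (\prod_i law (X 0%N) (Q 0%N) (g i))%:E.
  (* Independence is assumed for the communities jointly with their parameters, so the whole space
     is taken in the parameter component. *)
  have pre (i : 'I_m) : (fun w => ((minn (X i.+1 w) n, Q i.+1 w), G i w)) @^-1` (setT `*` [set g i]) =
      G i @^-1` [set g i].
    by apply/seteqP; split => [w []|w].
  have mB (i : 'I_m) : i \in index_enum 'I_m -> measurable (setT `*` [set g i] : set (nat * R * community n)).
    by move=> _; exact: measurableX.
  rewrite (_ : F g = \bigcap_(i in [set` index_enum 'I_m])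
    ((fun w => ((minn (X i.+1 w) n, Q i.+1 w), G i w)) @^-1` (setT `*` [set g i]))); last first.
    apply/seteqP; split => w Fw i _; first by split => //; exact: Fw.
    by have [] := Fw i (mem_index_enum i).
  rewrite (indep _ _ (index_enum_uniq _) mB) -prodEFin.
  by apply: eq_bigr => i _; rewrite pre community_law.
have -> : [set w | p [ffun i => G i w]] = \bigcup_(g in [set` enum p]) F g.
  apply/seteqP; split => [w pw|w [g]] /=.
    by exists [ffun i => G i w]; [rewrite /= mem_enum|move=> i _; rewrite /= ffunE].
  rewrite /= mem_enum => pg Fg; suff -> : [ffun i => G i w] = g by [].
  by apply/ffunP => i; rewrite ffunE; exact: Fg.
rewrite measure_fin_bigcup; first last.
- by move=> g _; apply: fin_bigcap_measurable => // i _; exact: mGi.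
- move=> g g' _ _ [w [gw g'w]]; apply/ffunP => i.
  by rewrite -(gw i)// -(g'w i).
- exact: finite_seq.
rewrite -fsbig_seq ?enum_uniq// big_enum /= /family_weight -sumEFin.
by apply: eq_bigr => g _; exact: FE.
Qed.

End community_family.
End communities_law.

(** * Connectivity for a fixed number of vertices *)

Lemma sum_expr_card (R : realType) n (a : R) :
  \sum_(S : {set 'I_n}) a ^+ #|S| = (1 + a) ^+ n.
Proof.
rewrite addrC -[X in _ ^+ X]card_ord -prodr_const bigA_distr; apply: eq_bigr => S _.
by rewrite -prodr_const big_mkcond.
Qed.

Lemma sum_expr_card_gt0 (R : realType) n (a : R) :
  \sum_(S : {set 'I_n} | (0 < #|S|)%N) a ^+ #|S| = (1 + a) ^+ n - 1.
Proof.
rewrite -sum_expr_card [in RHS](bigD1 finset.set0)//= cards0 expr0 addrC addrK.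
by apply: eq_bigl => S; rewrite card_gt0.
Qed.

Lemma expr_1D_le (R : realType) n (a : R) : 0 <= a -> (1 + a) ^+ n <= expR (n%:R * a).
Proof.
move=> a0; rewrite mulrC expRM_natr; apply: lerXn2r; rewrite ?nnegrE ?expR_ge0 ?addr_ge0//.
exact: expR_ge1Dx.
Qed.

Lemma expr_1B_le (R : realType) n (x y : R) : 0 <= x -> x <= 1 - y -> x ^+ n <= expR (- (n%:R * y)).
Proof.
move=> x0 xy; rewrite -mulrN mulrC expRM_natr; apply: lerXn2r; rewrite ?nnegrE ?expR_ge0//.
by apply: le_trans xy _; exact: expR_ge1Dx.
Qed.

(** Since (1 - q) (1 + q + 2 q^2) = 1 + q^2 (1 - 2 q) >= 1. *)
Lemma expR_1B_ge (R : realType) (q : R) : 0 <= q <= 2^-1 ->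
  expR (- (q + 2 * q ^+ 2)) <= 1 - q.
Proof.
move=> /andP[q0 q2]; rewrite expRN -[leLHS]mul1r ler_pdivrMr ?expR_gt0//.
apply: (@le_trans _ _ ((1 - q) * (1 + (q + 2 * q ^+ 2)))).
  have : 0 <= q ^+ 2 * (1 - 2 * q) by rewrite mulr_ge0 ?sqr_ge0//; lra.
  lra.
by apply: ler_wpM2l; [lra|exact: expR_ge1Dx].
Qed.

Section fixed_size_bounds.
Context (R : realType) (d : measure_display) (Omega : measurableType d)
  (P : probability Omega R) (X : {RV P >-> nat}) (Q : {RV P >-> R}).
Hypothesis Q01 : forall w, 0 <= Q w <= 1.
Hypothesis xh_ln : integ X Q (fun x q => xh x q * ln (1 + x%:R)).
Variables (n m : nat).

Let kappa : R := mean X Q (@xh R).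
Let L : R := ln n%:R.
Let r : R := m%:R / n%:R.

Lemma uncut_weight_ge0 (S : {set 'I_n}) : 0 <= uncut_weight (@law _ _ _ P X Q n) S.
Proof. by apply: sumr_ge0 => g _; exact: law_ge0. Qed.

(** The union bound is split at |S| = n^(1 - 2 delta), with T = n^delta. Small sets give the first
    term, where the empty set accounts for the - 1; large sets give the second one. *)
Lemma disconnected_le (delta : R) : (2 <= n)%N -> 0 < delta <= 1 ->
  family_weight (m := m) (@law _ _ _ P X Q n)
    (fun g => ~~ connected_graph (affiliation_graph g)) <=
  expR (expR (L - r * ((kappa - tail X Q (expR (delta * L))) * (1 - expR (- (delta * L)))))) - 1
  + expR (expR ((1 + delta) * L - r * (link_mean X Q / 4))
          - delta * L * expR ((1 - 2 * delta) * L)).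
Proof.
move=> n2 /andP[d0 d1].
have n0 : 0 < n%:R :> R by rewrite ltr0n (leq_trans _ n2).
have nE : n%:R = expR L by rewrite lnK.
have L0 : 0 <= L by rewrite ln_ge0// ler1n (leq_trans _ n2).
set kap := kappa - _.
have kap0 : 0 <= kap by rewrite subr_ge0 tail_le.
set T := expR (delta * L) in kap kap0 *.
set e := expR (- (delta * L)).
set c := link_mean X Q.
pose K : R := expR ((1 - 2 * delta) * L).
pose a := expR (- (r * (kap * (1 - e)))).
pose a2 := expR (delta * L - r * (c / 4)).
have Tn : T <= n%:R.
  by rewrite nE ler_expR ler_piMl.
apply: (le_trans (family_weight_disconnected_le _ _)); first exact: law_ge0.
apply: (@le_trans _ _ (\sum_(S : {set 'I_n} | (0 < #|S|)%N) (a ^+ #|S|) +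
    \sum_(S : {set 'I_n}) (expR (- (delta * L * K)) * a2 ^+ #|S|))).
  rewrite [leLHS]big_mkcond [X in _ <= X + _]big_mkcond -big_split /=; apply: ler_sum => S _.
  have a0 : 0 <= a ^+ #|S| by rewrite exprn_ge0 ?expR_ge0.
  have a20 : 0 <= expR (- (delta * L * K)) * a2 ^+ #|S|.
    by rewrite mulr_ge0 ?exprn_ge0 ?expR_ge0.
  case: ifP => [/andP[S0 Sn]|_]; last by rewrite addr_ge0//; case: ifP.
  (* If |S| <= [K], then |S| T / n <= n^(-delta) = [e], which yields a factor [a] per element of
     [S]. *)
  rewrite S0; have [SK|SK] := lerP #|S|%:R K.
    apply: ler_wpDr => //.
    apply: (le_trans (expr_1B_le _ (uncut_weight_ge0 S)
      (uncut_weight_le Q01 xh_ln S (leq_trans _ n2) Tn))) => //.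
    rewrite /a -expRM_natr ler_expR mulNr lerN2 -/kap.
    rewrite /r [leRHS](_ : _ = m%:R / n%:R * kap * #|S|%:R * (1 - #|S|%:R * T / n%:R)); last by ring.
    rewrite [leLHS](_ : _ = m%:R / n%:R * kap * #|S|%:R * (1 - e)); last by ring.
    apply: ler_wpM2l; first by rewrite !mulr_ge0// invr_ge0 ltW.
    rewrite lerD2l lerN2 ler_pdivrMr// nE /e -expRD.
    apply: le_trans (ler_wpM2r (expR_ge0 _) SK) _.
    by rewrite /K -expRD ler_expR le_eqVlt; apply/orP; left; apply/eqP; ring.
  (* If |S| > [K], the factor exp(delta L (|S| - K)) >= 1 is inserted: its part in |S| goes into
     [a2], the rest is a small prefactor of the sum over all sets. *)
  apply: ler_wpDl => //.
  have uncut_le := expr_1B_le m (uncut_weight_ge0 S) (uncut_weight_le_link X Q01 n2 Sn).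
  apply: (le_trans uncut_le).
  rewrite /a2 -expRM_natr -expRD ler_expR -/c.
  rewrite [leLHS](_ : _ = - (r * (c / 4) * #|S|%:R)); last by rewrite /r; ring.
  have : delta * L * K <= delta * L * #|S|%:R.
    apply: ler_wpM2l (ltW SK).
    by apply: mulr_ge0 => //; exact: ltW.
  lra.
rewrite -mulr_sumr sum_expr_card_gt0 sum_expr_card; apply: lerD.
  rewrite lerD2r; apply: le_trans (expr_1D_le _ (expR_ge0 _)) _.
  by rewrite nE -expRD.
apply: (@le_trans _ _ (expR (- (delta * L * K)) * expR (n%:R * a2))).
  by rewrite ler_wpM2l ?expR_ge0 ?expr_1D_le ?expR_ge0.
rewrite -expRD ler_expR nE -expRD addrC lerD2r ler_expR.
by rewrite le_eqVlt; apply/orP; left; apply/eqP; ring.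
Qed.

(** Dividing the second moment inequality by [EN]^2 leaves 1 / [EN] plus the relative excess due to
    the correlation of two vertices. *)
Lemma connected_le (T : R) : (2 <= n)%N -> 0 <= T -> 2 * kappa <= n%:R -> r * kappa <= L ->
  family_weight (m := m) (@law _ _ _ P X Q n)
    (fun g => connected_graph (affiliation_graph g)) <=
  expR (2 * kappa - (L - r * kappa)) +
  (expR (4 * (r * (kappa * (T / n%:R) + tail X Q T))) - 1).
Proof.
move=> n2 T0 kn rL.
have n0 : 0 < n%:R :> R by rewrite ltr0n (leq_trans _ n2).
have nE : n%:R = expR L by rewrite lnK.
have kappa0 : 0 <= kappa by apply: mean_ge0 => // x q; exact: xh_ge0.
have t0 := tail_ge0 X Q01 T.
set p := degree_prob X Q n; have p0 : 0 <= p := degree_prob_ge0 X Q01 n.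
have pk : p <= kappa / n%:R := degree_prob_le Q01 xh_ln n.
have p2 : p <= 2^-1 by apply: le_trans pk _; rewrite ler_pdivrMr//; lra.
set rho := (T * kappa + n%:R * tail X Q T) / n%:R ^+ 2.
have rho0 : 0 <= rho by rewrite divr_ge0 ?addr_ge0 ?mulr_ge0 ?exprn_ge0// ltW.
have p20 : 0 <= 1 - 2 * p + rho by lra.
have := @family_weight_connected_le R n m (@law _ _ _ P X Q n) (law_ge0 X Q01 (n:=n))
  (law1 X Q01 n) (1 - p) (1 - 2 * p + rho) n2 p20 (uncut_weight1 Q01 xh_ln (n:=n))
  (fun u v uv => uncut_weight2_le Q01 xh_ln uv T0).
set F := family_weight _ _; set EN := n%:R * _.
(* By [expR_1B_ge] the exponent is at least L - m p - 2 m p^2. Here m p <= r kappa <= L and p <=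
   kappa / n, so m p^2 <= L kappa / n <= kappa. *)
have EN_ge : expR ((L - r * kappa) - 2 * kappa) <= EN.
  apply: (@le_trans _ _ (expR (L - m%:R * (p + 2 * p ^+ 2)))).
    rewrite ler_expR -addrA lerD2l.
    have mp : m%:R * p <= r * kappa.
      by rewrite /r mulrAC -mulrA ler_wpM2l.
    have mp2 : m%:R * p * p <= L * (kappa / n%:R).
      by apply: ler_pM => //; [rewrite mulr_ge0|apply: le_trans rL].
    have Ln : L / n%:R <= 1.
      by rewrite ler_pdivrMr// mul1r nE -[leLHS]add0r (le_trans _ (expR_ge1Dx _))// lerD2r.
    have : L / n%:R * kappa <= kappa by rewrite ler_piMl.
    lra.
  rewrite expRD -nE ler_wpM2l ?(ltW n0)// -mulrN mulrC expRM_natr.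
  apply: lerXn2r; rewrite ?nnegrE ?expR_ge0//; first lra.
  by apply: expR_1B_ge; rewrite p0.
have EN0 : 0 < EN by apply: lt_le_trans EN_ge; exact: expR_gt0.
(* As p <= 1/2, one has 1 - 2 p + rho <= (1 - p)^2 (1 + 4 rho); the power [m] of the last factor is
   at most exp(4 m rho). *)
have EN2 : n%:R ^+ 2 * (1 - 2 * p + rho) ^+ m <=
    EN ^+ 2 * expR (4 * (r * (kappa * (T / n%:R) + tail X Q T))).
  rewrite [leRHS](_ : _ = n%:R ^+ 2 * ((1 - p) ^+ m ^+ 2 *
    expR (4 * (r * (kappa * (T / n%:R) + tail X Q T))))); last by rewrite [RHS]mulrA /EN exprMn.
  rewrite ler_wpM2l ?exprn_ge0 ?(ltW n0)//.
  rewrite exprAC.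
  apply: (@le_trans _ _ (((1 - p) ^+ 2 * (1 + 4 * rho)) ^+ m)).
    apply: lerXn2r; rewrite ?nnegrE//.
      by rewrite mulr_ge0 ?sqr_ge0//; lra.
    have h1 : 4^-1 <= (1 - p) ^+ 2.
      (* This product equals (1 - p)^2 - 1/4. *)
      have : 0 <= (1 / 2 - p) * (3 / 2 - p) by apply: mulr_ge0; lra.
      lra.
    have h2 : 4^-1 * rho <= (1 - p) ^+ 2 * rho by rewrite ler_wpM2r.
    have : 0 <= p ^+ 2 by rewrite sqr_ge0.
    lra.
  rewrite exprMn; apply: ler_wpM2l; first by apply: exprn_ge0; exact: sqr_ge0.
  apply: le_trans (expr_1D_le _ _) _; first by rewrite mulr_ge0.
  rewrite ler_expR le_eqVlt; apply/orP; left; apply/eqP.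
  by rewrite /rho /r; field; rewrite gt_eqF.
move=> bound.
have {}bound : F * EN ^+ 2 <= (EN^-1 + (expR (4 * (r * (kappa * (T / n%:R) + tail X Q T))) - 1)) * EN ^+ 2.
  apply: le_trans bound _; set E := expR _ in EN2 *.
  rewrite [leRHS](_ : _ = EN + EN ^+ 2 * E - EN ^+ 2); last by field; rewrite gt_eqF.
  by rewrite lerD2r lerD2l.
rewrite ler_pM2r ?exprn_gt0// in bound.
apply: le_trans bound _; rewrite lerD2r.
rewrite -(opprB _ (2 * kappa)) expRN lef_pV2 ?posrE ?expR_gt0//.
Qed.

End fixed_size_bounds.

(** * Asymptotics *)

Section limits.
Context (R : realType).
Implicit Types (u L r : nat -> R).

Lemma cvg_expR_Ny u : u n @[n --> \oo] --> -oo -> expR (u n) @[n --> \oo] --> (0 : R).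
Proof.
move=> uNy; have uy : (- u n) @[n --> \oo] --> +oo by apply/cvgNry.
have := cvg_comp _ _ uy (@cvgr_expR R).
by apply: cvg_trans; apply: near_eq_cvg; apply: nearW => n /=; rewrite opprK.
Qed.

Lemma cvg_ln_nat : ln n%:R @[n --> \oo] --> (+oo : set_system R).
Proof.
apply/cvgryPge => A; near=> n.
have An : expR A <= n%:R by near: n; exact: cvgry_ge cvgr_idn _.
by rewrite -[leLHS]expRK ler_ln ?posrE ?expR_gt0// (lt_le_trans _ An) ?expR_gt0.
Unshelve. all: by end_near. Qed.

Lemma cvg_scale_Ny L (a : R) : 0 < a -> L n @[n --> \oo] --> +oo ->
  - (a * L n) @[n --> \oo] --> -oo.
Proof.
move=> a0 Ly; apply/cvgrNyPle => A; near=> n.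
have : - A / a <= L n by near: n; exact: cvgry_ge.
by rewrite ler_pdivrMr// mulrC lerNl.
Unshelve. all: by end_near. Qed.

(** Half of the exponent absorbs the factor L, by x exp(-x) <= 1 at x = a L / 2; the other half
    tends to 0. *)
Lemma cvg_mul_expRN L (a : R) : 0 < a -> L n @[n --> \oo] --> +oo ->
  L n * expR (- (a * L n)) @[n --> \oo] --> (0 : R).
Proof.
move=> a0 Ly.
have half_a : 0 < a / 2 by lra.
apply: (@squeeze_cvgr _ _ _ _ (fun=> 0) (fun n => (a / 2)^-1 * expR (- (a / 2 * L n)))).
- near=> n; have L0 : 0 <= L n by near: n; exact: cvgry_ge.
  rewrite mulr_ge0 ?expR_ge0//=.
  set x := a / 2 * L n.
  have x1 : x * expR (- x) <= 1.
    rewrite expRN ler_pdivrMr ?expR_gt0// mul1r.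
    by apply: le_trans (expR_ge1Dx _); rewrite lerDr.
  have -> : L n * expR (- (a * L n)) = (a / 2)^-1 * (x * expR (- x) * expR (- x)).
    rewrite -mulrA -expRD /x (_ : - (a * L n) = - (a / 2 * L n) - a / 2 * L n); last by field.
    by field; rewrite gt_eqF.
  by rewrite ler_wpM2l ?invr_ge0 ?(ltW half_a)// ler_piMl ?expR_ge0.
- exact: cvg_cst.
- rewrite -[X in _ --> X](mulr0 (a / 2)^-1); apply: cvgMr.
  by apply: cvg_expR_Ny; exact: cvg_scale_Ny.
Unshelve. all: by end_near. Qed.

(** Write lambda for L - r kappa. The product (kappa - t) (1 - e) is kappa - [eps], with L [eps] <=
    kappa / 2 eventually. As r = (L - lambda) / kappa, the error r [eps] is at most 1/2 - lambda /
    2, so half of lambda survives. *)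
Lemma cvg_supercritical (kappa : R) L r (t e : nat -> R) : 0 < kappa ->
  L n @[n --> \oo] --> +oo -> (L n - r n * kappa) @[n --> \oo] --> -oo ->
  (forall n, 0 <= t n <= kappa) -> (forall n, 0 <= e n) ->
  t n * L n @[n --> \oo] --> (0 : R) -> L n * e n @[n --> \oo] --> (0 : R) ->
  L n - r n * ((kappa - t n) * (1 - e n)) @[n --> \oo] --> -oo.
Proof.
move=> k0 Ly lNy tk e0 tL eL; apply/cvgrNyPle => A; near=> n.
have L1 : 1 <= L n by near: n; exact: cvgry_ge.
(* The final upper bound is (lambda + 1) / 2, hence the threshold 2 A - 1. *)
have lA : L n - r n * kappa <= 2 * A - 1 by near: n; exact: cvgrNy_le.
have l0 : L n - r n * kappa <= 0 by near: n; exact: cvgrNy_le.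
have tL4 : t n * L n <= kappa / 4.
  by apply: ltW; near: n; apply: (cvgr_lt _ tL); rewrite divr_gt0.
have eL4 : L n * e n <= 4^-1 by apply: ltW; near: n; apply: (cvgr_lt _ eL).
have /andP[t0 tn] := tk n; have en := e0 n.
pose eps := t n + (kappa - t n) * e n.
have epsL : eps * L n <= kappa / 2.
  have : (kappa - t n) * (L n * e n) <= kappa * 4^-1.
    apply: ler_pM => //; first by rewrite subr_ge0.
      by rewrite mulr_ge0// (le_trans _ L1).
    by rewrite gerBl.
  rewrite /eps; lra.
have eps0 : 0 <= eps by rewrite addr_ge0// mulr_ge0// subr_ge0.
have epsk : eps <= kappa / 2.
  by apply: le_trans epsL; rewrite ler_peMr.
have rE : r n = (L n - (L n - r n * kappa)) / kappa by field; rewrite gt_eqF.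
have reps : r n * eps <= 2^-1 - (L n - r n * kappa) / 2.
  rewrite {1}rE mulrAC ler_pdivrMr// mulrBl.
  have : (r n * kappa - L n) * eps <= (r n * kappa - L n) * (kappa / 2).
    by apply: ler_wpM2l => //; lra.
  lra.
have -> : L n - r n * ((kappa - t n) * (1 - e n)) = L n - r n * kappa + r n * eps.
  by rewrite /eps; ring.
lra.
Unshelve. all: by end_near. Qed.

End limits.

(** * Limits of the two bounds for the generic pair *)

Section generic_limits.
Context (R : realType) (d : measure_display) (Omega : measurableType d)
  (P : probability Omega R) (X : {RV P >-> nat}) (Q : {RV P >-> R}).
Hypothesis Q01 : forall w, 0 <= Q w <= 1.
Hypothesis xh_ln : integ X Q (fun x q => xh x q * ln (1 + x%:R)).
Hypothesis link_gt0 : 0 < link_mean X Q.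
Variable m : nat -> nat.

Let kappa : R := mean X Q (@xh R).
Let L (n : nat) : R := ln n%:R.
Let r (n : nat) : R := (m n)%:R / n%:R.
Let mu n := @law _ _ _ P X Q n.

(** With T = n^a one has a L <= ln(1 + T), which reduces the claim to [tail_ln_cvg]. *)
Lemma cvg_tail_ln (a : R) : 0 < a -> tail X Q (expR (a * L n)) * L n @[n --> \oo] --> (0 : R).
Proof.
move=> a0.
have Ty : expR (a * L n) @[n --> \oo] --> +oo.
  apply/cvgryPge => A; near=> n.
  have : A / a <= L n by near: n; exact: cvgry_ge (@cvg_ln_nat R) _.
  rewrite ler_pdivrMr// => AL; apply: le_trans (expR_ge1Dx _).
  by rewrite mulrC -[leLHS]add0r lerD.
apply: (@squeeze_cvgr _ _ _ _ (fun=> 0)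
  (fun n => a^-1 * (tail X Q (expR (a * L n)) * ln (1 + expR (a * L n))))).
- near=> n; have L0 : 0 <= L n by near: n; exact: cvgry_ge (@cvg_ln_nat R) _.
  have t0 := tail_ge0 X Q01 (expR (a * L n)).
  rewrite mulr_ge0//= mulrCA ler_wpM2l// ler_pdivlMl//.
  have T1 : 0 < 1 + expR (a * L n) by rewrite addr_gt0 ?expR_gt0.
  by rewrite -[leLHS]expRK ler_ln ?posrE ?expR_gt0 ?lerDr.
- exact: cvg_cst.
- rewrite -[X in _ --> X](mulr0 a^-1); apply: cvgMr.
  exact: tail_ln_cvg.
Unshelve. all: by end_near. Qed.

Lemma kappa_gt0 : 0 < kappa.
Proof. exact: lt_le_trans link_gt0 (link_mean_le Q01 xh_ln). Qed.

Lemma disconnected_cvg : (L n - r n * kappa) @[n --> \oo] --> -oo ->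
  family_weight (m := m n) (@mu n) (fun g => ~~ connected_graph (affiliation_graph g))
    @[n --> \oo] --> (0 : R).
Proof.
move=> lNy; have k0 := kappa_gt0.
have Ly : L n @[n --> \oo] --> +oo := @cvg_ln_nat R.
have ck : link_mean X Q <= kappa := link_mean_le Q01 xh_ln.
(* Chosen so that a quarter of [link_mean] is 3 a kappa, which gives a gain 3 a L once r kappa >=
   L. *)
pose a := link_mean X Q / (12 * kappa).
have a0 : 0 < a by rewrite divr_gt0// mulr_gt0.
have a12 : a <= 12^-1 by rewrite ler_pdivrMr ?mulr_gt0//; lra.
apply: (@squeeze_cvgr _ _ _ _ (fun=> 0) (fun n =>
  expR (expR (L n - r n * ((kappa - tail X Q (expR (a * L n))) * (1 - expR (- (a * L n)))))) - 1
  + expR (1 - a * L n))).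
- near=> n.
  have n2 : (2 <= n)%N by near: n; exact: nbhs_infty_ge.
  rewrite family_weight_ge0 /=; last by exact: law_ge0.
  apply: (le_trans (disconnected_le Q01 xh_ln (m n) n2 (delta := a) _)).
    by rewrite a0; lra.
  rewrite lerD2l ler_expR.
  have L1 : a^-1 <= L n by near: n; exact: cvgry_ge.
  have L0 : 0 <= L n by apply: le_trans L1; rewrite invr_ge0 ltW.
  have aL : 1 <= a * L n by rewrite -ler_pdivrMl// mulr1.
  have l0 : L n - r n * kappa <= 0 by near: n; exact: cvgrNy_le.
  (* The exponent is at most (1 + a) L - 3 a L. Hence this term is at most the threshold n^(1 - 2 a)
     on |S|, and a L times that threshold is subtracted from it. *)
  have e1 : expR ((1 + a) * L n - r n * (link_mean X Q / 4)) <= expR ((1 - 2 * a) * L n).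
    rewrite ler_expR.
    have -> : link_mean X Q / 4 = 3 * a * kappa.
      by rewrite /a; field; rewrite gt_eqF.
    have : 3 * a * L n <= 3 * a * (r n * kappa).
      by apply: ler_wpM2l; [lra|rewrite -subr_le0].

    lra.
  have e2 : 1 <= expR ((1 - 2 * a) * L n).
    by rewrite -[leLHS]expR0 ler_expR mulr_ge0//; lra.
  (* As a L >= 1, the difference (1 - a L) n^(1 - 2 a) is at most 1 - a L. *)
  have : (a * L n - 1) * 1 <= (a * L n - 1) * expR ((1 - 2 * a) * L n).
    by rewrite ler_wpM2l// subr_ge0.
  rewrite -/(L n) -/(r n); lra.
- exact: cvg_cst.
- rewrite -[X in _ --> X](_ : (expR 0 - 1) + 0 = 0); last by rewrite expR0 subrr addr0.
  apply: cvgD; last first.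
    apply: cvg_expR_Ny; apply/cvgrNyPle => A; near=> n.
    have : - (a * L n) <= A - 1 by near: n; exact: cvgrNy_le (cvg_scale_Ny a0 Ly) _.
    lra.
  apply: cvgB; last exact: cvg_cst.
  apply: (continuous_cvg _ (@continuous_expR R 0)).
  apply: cvg_expR_Ny; apply: (cvg_supercritical (t := fun n => tail X Q (expR (a * L n)))
    (e := fun n => expR (- (a * L n))) k0 Ly lNy).
  + by move=> n; rewrite tail_ge0//= tail_le.
  + by move=> n; exact: expR_ge0.
  + exact: cvg_tail_ln.
  + exact: cvg_mul_expRN.
Unshelve. all: by end_near. Qed.

(** With T = n^(1/2), T / n = exp(- L / 2). Eventually r kappa <= L, so r is replaced by L / kappa,
    and both products with L tend to 0. *)
Lemma connected_cvg : (L n - r n * kappa) @[n --> \oo] --> +oo ->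
  family_weight (m := m n) (@mu n) (fun g => connected_graph (affiliation_graph g))
    @[n --> \oo] --> (0 : R).
Proof.
move=> ly; have k0 := kappa_gt0.
have Ly : L n @[n --> \oo] --> +oo := @cvg_ln_nat R.
apply: (@squeeze_cvgr _ _ _ _ (fun=> 0) (fun n =>
  expR (2 * kappa - (L n - r n * kappa)) +
  (expR (4 * (L n * expR (- (2^-1 * L n)) + kappa^-1 * (tail X Q (expR (2^-1 * L n)) * L n))) - 1))).
- near=> n.
  have n2 : (2 <= n)%N by near: n; exact: nbhs_infty_ge.
  have n0 : 0 < n%:R :> R by rewrite ltr0n (leq_trans _ n2).
  have nE : n%:R = expR (L n) by rewrite lnK.
  have kn : 2 * kappa <= n%:R by near: n; exact: cvgry_ge cvgr_idn _.
  have l0 : 0 <= L n - r n * kappa by near: n; exact: cvgry_ge.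
  have rL : r n * kappa <= L n by lra.
  rewrite family_weight_ge0 /=; last by exact: law_ge0.
  apply: (le_trans (connected_le Q01 xh_ln n2 (expR_ge0 (2^-1 * L n)) kn rL)).
  rewrite -/(L n) -/(r n) lerD2l lerD2r ler_expR ler_wpM2l//.
  have -> : expR (2^-1 * L n) / n%:R = expR (- (2^-1 * L n)).
    by rewrite nE -expRN -expRD; congr expR; field.
  set t := tail _ _ _; set e := expR _.
  have t0 : 0 <= t by exact: tail_ge0.
  have e0 : 0 <= e by exact: expR_ge0.
  have -> : r n * (kappa * e + t) = (r n * kappa) * (e + kappa^-1 * t).
    by field; rewrite gt_eqF.
  have -> : L n * e + kappa^-1 * (t * L n) = L n * (e + kappa^-1 * t) by ring.
  by rewrite ler_wpM2r// addr_ge0// mulr_ge0// invr_ge0 ltW.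
- exact: cvg_cst.
- rewrite -[X in _ --> X](_ : 0 + (expR (4 * (0 + kappa^-1 * 0)) - 1) = 0); last first.
    by rewrite mulr0 addr0 mulr0 expR0 subrr addr0.
  apply: cvgD.
    apply: cvg_expR_Ny; apply/cvgrNyPle => A; near=> n.
    have : 2 * kappa - A <= L n - r n * kappa by near: n; exact: cvgry_ge.
    lra.
  apply: cvgB; last exact: cvg_cst.
  apply: (continuous_cvg _ (@continuous_expR R _)).
  apply: cvgMr; apply: cvgD; first exact: cvg_mul_expRN.
  by apply: cvgMr; exact: cvg_tail_ln.
Unshelve. all: by end_near. Qed.

End generic_limits.

(* [(X 0, Q 0)] is the generic pair; the communities use [(X i, Q i)], [i >= 1]. *)
Theorem proposition1 (R : realType) (d : measure_display)
    (Omega : measurableType d) (P : probability Omega R)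
    (X : nat -> {RV P >-> nat}) (Q : nat -> {RV P >-> R})
    (m : nat -> nat) (G : forall n : nat, 'I_(m n) -> Omega -> community n)
    (Q01 : forall i w, 0 <= Q i w <= 1)
    (XQ_indep : mutually_independent P (fun i w => (X i w, Q i w)))
    (XQ_ident : forall (i : nat) (B : set (nat * R)), measurable B ->
       P ((fun w => (X i w, Q i w)) @^-1` B) = P ((fun w => (X 0%N w, Q 0%N w)) @^-1` B))
    (Q_pos : (0 < 'E_P[fun w => (Q 0%N w * \1_[set w | (2 <= X 0%N w)%N] w)%R])%E)
    (XhlnX_fin : ('E_P[fun w =>
       ((X 0%N w)%:R * h (X 0%N w) (Q 0%N w) * ln (1 + (X 0%N w)%:R))%R] < +oo)%E)
    (m_pos : forall n, (0 < n)%N -> (0 < m n)%N)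
    (m_oo : m n @[n --> \oo] --> \oo)
    (G_comm : forall n, (0 < n)%N ->
       communities P (fun i w => (minn (X i.+1 w) n, Q i.+1 w)) (G n)) :
  let kappa : R := fine 'E_P[fun w => ((X 0%N w)%:R * h (X 0%N w) (Q 0%N w))%R] in
  let lambda' (n : nat) : R := ln n%:R - (m n)%:R / n%:R * kappa in
  let prob_connected (n : nat) : \bar R :=
    P [set w | connected_graph (affiliation_graph (fun i => G n i w))] in
  (lambda' n @[n --> \oo] --> +oo -> prob_connected n @[n --> \oo] --> 0%E) /\
  (lambda' n @[n --> \oo] --> -oo -> prob_connected n @[n --> \oo] --> 1%E).

Proof.
move=> kappa lambda' prob_connected.
have measurable_xh_ln : measurable_fun setT (fun w =>
    xh (X 0%N w) (Q 0%N w) * ln (1 + (X 0%N w)%:R)).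
  apply: (@measurable_pairfun _ _ _ _ (X 0%N) (Q 0%N) (fun x q => xh x q * ln (1 + x%:R))) => x.
  by apply: measurable_funM => //; exact: measurable_xh.
(* The integrand is nonnegative, so its finite expectation gives integrability. *)
have xh_ln : integ (X 0%N) (Q 0%N) (fun x q => xh x q * ln (1 + x%:R)).
  apply/integrableP; split; first exact/measurable_EFinP.
  move: XhlnX_fin; rewrite unlock; congr (_ < _)%E; apply: eq_integral => w _ /=.
  by rewrite ger0_norm// xhM_ge0// ln_ge0// lerDl.
have link_gt0 : 0 < link_mean (X 0%N) (Q 0%N).
  have linkE : ('E_P[fun w => (Q 0%N w * \1_[set w | (2 <= X 0%N w)%N] w)%R] =
      \int[P]_w (Q 0%N w * (2 <= X 0%N w)%N%:R)%:E)%E.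
    rewrite unlock; apply: eq_integral => w _; rewrite indicE; congr (_ * (nat_of_bool _)%:R)%:E.
    by apply/idP/idP; rewrite inE.
  have link_fin := integrable_fin_num measurableT (integ_link (X 0%N) (Q01 0%N)).
  by rewrite -lte_fin fineK//= -linkE.
have kappaE : kappa = mean (X 0%N) (Q 0%N) (@xh R) by rewrite /kappa unlock.
(* The passage from [P] to product weights; [family_prob] speaks of finite functions, whose
   affiliation graph is the same. *)
have probE n : (0 < n)%N -> prob_connected n = (family_weight (m := m n)
    (@law _ _ _ P (X 0%N) (Q 0%N) n) (fun g => connected_graph (affiliation_graph g)))%:E.
  move=> n0; rewrite -(family_prob Q01 XQ_ident (G_comm n n0)); congr (P _).
  have graphE w : affiliation_graph [ffun i => G n i w] = affiliation_graph (fun i => G n i w).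
    by apply: eq_bigr => i _; rewrite ffunE.
  by apply/seteqP; split => w /=; rewrite graphE.
split => lambda_cvg.
  apply: (@cvg_trans _ ((family_weight (m := m n) (@law _ _ _ P (X 0%N) (Q 0%N) n)
     (fun g => connected_graph (affiliation_graph g)))%:E @[n --> \oo])).
    (* The communities are specified for [n > 0] only, so the two sequences agree eventually. *)
    by apply: near_eq_cvg; near=> n; rewrite probE//; near: n; exact: nbhs_infty_gt.
  apply: cvg_EFin; first exact: nearW.
  apply: connected_cvg => //. rewrite -kappaE; exact: lambda_cvg.
apply: (@cvg_trans _ ((1 - family_weight (m := m n) (@law _ _ _ P (X 0%N) (Q 0%N) n)
     (fun g => ~~ connected_graph (affiliation_graph g)))%:E @[n --> \oo])).
  apply: near_eq_cvg; near=> n; rewrite probE; last by near: n; exact: nbhs_infty_gt.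
  by rewrite [in RHS](family_weightC (law1 (X 0%N) (Q01 0%N) n)).
apply: cvg_EFin; first exact: nearW.
rewrite -[X in _ --> X]subr0; apply: cvgB; first exact: cvg_cst.
apply: disconnected_cvg => //; rewrite -kappaE; exact: lambda_cvg.
Unshelve. all: by end_near. Qed.
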